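(* Let $\alpha>0$ and let $X_1,X_2,\ldots$ be i.i.d. nonnegative with distribution $F$ given by $1-F(x)=e^{-x^\alpha}$, $x\ge0$. For $\beta>1$ let $$T_k^*=\frac{T_k}{\sum_{j=1}^{k-1}[1-F(\beta\overline{Y}_j)]^{-1}}.$$ Then as $k\to\infty$: (i) $T_k^*\to1$ almost surely, for $1<\beta<1+\frac1{2\alpha}$; (ii) $T_k^*\to1$ in probability, for $1+\frac1{2\alpha}\le\beta<1+\frac1\alpha$; (iii) $T_k^*\to\operatorname{Exp}(1)$ in distribution and $\dfrac{T_k}{e^{\beta^\alpha\overline{Y}_{k-1}^\alpha}}\to\operatorname{Exp}(1)$ in distribution, for $\beta>1+\frac1\alpha$.
   Context: Selection rule. For i.i.d. observations $X_1,X_2,\ldots$ with distribution function $F$ and fixed $\beta\ge1$, set $T_1=1$, $Y_1=X_1$, and inductively $T_{k+1}=\inf\{i>T_k: X_i>\beta\overline{Y}_k\}$, $Y_{k+1}=X_{T_{k+1}}$, where $\overline{Y}_k=\frac1k\sum_{j=1}^kY_j$ (the ''$\beta$-better than average rule''). Thus $T_k$ is the number of observations inspected until the $k$th item is retained. $\operatorname{Exp}(1)$ is the exponential distribution with mean 1. *)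

(* Defs.v *)
From HB Require Import structures.
From mathcomp Require Import all_boot all_order all_algebra finmap.
From mathcomp Require Import all_classical all_reals all_analysis.

Set Implicit Arguments.
Unset Strict Implicit.
Unset Printing Implicit Defensive.

Import Order.TTheory GRing.Theory Num.Theory.
Import numFieldNormedType.Exports.

Local Open Scope classical_set_scope.
Local Open Scope ring_scope.

(* Selection rule along one sample path. The observations X_1, X_2, ... are
   x 0, x 1, ..., so that X_i is [x i.-1]; stages k and times T_k are counted
   from 1, as is usual for the rule. *)
Section selection_rule.
Context {R : realType}.
Implicit Types (F : R -> R) (beta c : R) (x : nat -> R) (t k n : nat).

(* inf {i > t : X_i > c}. The value 0 stands for inf set0; it is only taken on
   a null event when the X_i are i.i.d. with F < 1 everywhere. *)
Definition next_exceedance x c t : nat :=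
  if pselect (exists i, (t < i)%N && (c < x i.-1)) is left ex_i
  then ex_minn ex_i else 0%N.

(* The pair (T_(n+1), Y_1 + ... + Y_(n+1)); see selected_time1,
   selected_timeS and running_mean below. *)
Fixpoint selection beta x n : nat * R :=
  if n is m.+1 then
    let: (t, s) := selection beta x m in
    let t' := next_exceedance x (beta * (s / m.+1%:R)) t in
    (t', s + x t'.-1)
  else (1%N, x 0%N).

Definition selected_time beta x k : nat := (selection beta x k.-1).1.

Definition selected_value beta x k : R := x (selected_time beta x k).-1.

Definition running_mean beta x k : R :=
  (\sum_(1 <= j < k.+1) selected_value beta x j) / k%:R.

Lemma selected_time1 beta x : selected_time beta x 1 = 1%N.
Proof. by []. Qed.

Lemma selection_sum beta x n :
  (selection beta x n).2 = \sum_(1 <= j < n.+2) selected_value beta x j.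
Proof.
elim: n => [|n IHn]; first by rewrite big_nat1.
rewrite big_nat_recr//= -IHn /selected_value /selected_time /=.
by case: (selection beta x n).
Qed.

Lemma selected_timeS beta x k : (0 < k)%N ->
  selected_time beta x k.+1 =
  next_exceedance x (beta * running_mean beta x k) (selected_time beta x k).
Proof.
case: k => // k _; rewrite /running_mean -selection_sum /selected_time /=.
by case: (selection beta x k).
Qed.

Definition normalized_time F beta x k : R :=
  (selected_time beta x k)%:R /
  \sum_(1 <= j < k) (1 - F (beta * running_mean beta x j))^-1.

End selection_rule.

Definition weibull_cdf {R : realType} (alpha x : R) : R :=
  if 0 <= x then 1 - expR (- (x `^ alpha)) else 0.

Section probability_notions.
Context d (T : measurableType d) (R : realType) (P : probability T R).

Definition mutually_independent (X : nat -> {RV P >-> R}) : Prop :=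
  forall (J : {fset nat}) (B : nat -> set R),
    (forall i, measurable (B i)) ->
    P (\bigcap_(i in [set` J]) (X i @^-1` B i)) =
    (\prod_(i <- J) P (X i @^-1` B i))%E.

Definition cvg_almost_surely (Z : nat -> T -> R) (l : R) : Prop :=
  \forall w \ae P, Z n w @[n --> \oo] --> l.

(* Convergence in probability and in distribution are notions about random
   variables: measurability of each Z n is part of the two definitions. *)
Definition cvg_in_probability (Z : nat -> T -> R) (l : R) : Prop :=
  (forall n, measurable_fun [set: T] (Z n)) /\
  forall e : R, 0 < e ->
    P [set w | e < `|Z n w - l|] @[n --> \oo] --> 0%E.

Definition cvg_in_distribution (Z : nat -> T -> R) (mu : set R -> \bar R) :
    Prop :=
  (forall n, measurable_fun [set: T] (Z n)) /\
  forall a : R, {for a, continuous (fun b : R => mu `]-oo, b]%classic)} ->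
    P (Z n @^-1` `]-oo, a]) @[n --> \oo] --> mu `]-oo, a]%classic.

End probability_notions.

(* Main.v *)
(* Write a_k = 1/(1 - F(beta Ybar_k)) = exp(beta^alpha Ybar_k^alpha) and
   S_k = a_1 + ... + a_(k-1). Given the past at time T_k, the gap T_(k+1) - T_k is
   geometric with mean a_k, and S_(k+1) is already known.

   The rule forces Ybar_(k+1) >= Ybar_k (1 + (beta-1)/(k+1)), so that log a_k grows
   at least like k^gamma with gamma = alpha (beta-1). A Borel-Cantelli argument shows
   that eventually Y_(k+1) <= (beta+eta) Ybar_k almost surely, which gives the
   matching upper bound up to an arbitrarily small loss in the exponent. Hence, when
   gamma < 1, the share r_k = a_k/S_(k+1) is of order k^-(1-gamma) up to that loss.

   With D_k = T_k - 1 - S_k and V_k = (D_k/S_k)^2, conditioning on the past gives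
   E[V_(k+1) | past] <= (1-r_k)^2 V_k + r_k^2. On the event that the bounds on the
   shares hold, this contraction yields E V_k = O(k^-kappa) with kappa close to
   1-gamma, whence convergence in probability if gamma < 1. If gamma < 1/2 then
   kappa > 1/2, so E V_k is summable along the squares k = n^2, V_k -> 0 almost
   surely along them, and monotonicity of T and S fills the gaps because
   S_(n^2)/S_((n+1)^2) -> 1.

   If gamma > 1 then a_k/a_(k+1) -> 0 so fast that T_k/a_k -> 0 almost surely and
   S_(k+1)/a_k -> 1; only the last gap matters, and a geometric variable with mean
   a_k -> oo divided by a_k converges to Exp(1). *)
Require Import Defs.
From HB Require Import structures.
From mathcomp Require Import all_boot all_order all_algebra finmap.
From mathcomp Require Import all_classical all_reals all_analysis.
From mathcomp Require Import measurable_realfun ring lra zify.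

Set Implicit Arguments.
Unset Strict Implicit.
Unset Printing Implicit Defensive.

Import Order.TTheory GRing.Theory Num.Theory.
Import numFieldNormedType.Exports.

Local Open Scope classical_set_scope.
Local Open Scope ring_scope.

(** * The past of an independent sequence *)

(** Conditioning at the random time [T_k] uses no conditional expectation. The space is cut
    according to the value t of that time; on each piece a quantity known at stage k is unchanged
    when all observations after the first t are replaced by 0, and it is then a function of X_1,
    ..., X_t, so that independence and Tonelli apply at a fixed time. This yields upper bounds for
    integrals only; the limit law is recovered by bounding an event and its complement. The growth
    bounds hold with constants that depend on the path, already through X_1, which can be
    arbitrarily close to 0, while integrals need deterministic constants. Hence each bound is tied
    to an integer, K for 1/X_1 and N for the shares, and proved for every value of it; almost every
    path is covered by some value. The share bounds enter the second moment as an indicator that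
    stops at the current stage: the indicator of all of them at once would anticipate the future and
    break the conditioning. *)

Lemma measurable_natr_bool d (T : measurableType d) (R : realType) (b : T -> bool) :
  measurable_fun setT b -> measurable_fun setT (fun w => (b w)%:R : R).
Proof.
move=> mb; rewrite (_ : (fun w => _) = (fun w => if b w then 1 else 0 : R)).
  exact: measurable_fun_ifT.
by apply/funext => w; case: (b w).
Qed.

Section independent_sequence.
Context d (T : measurableType d) (R : realType) (P : probability T R).
Variable X : nat -> {RV P >-> R}.
Hypothesis X_indep : mutually_independent X.

(* A pi-system generating the sigma-algebra of X_0, ..., X_(n-1). *)
Definition past_cylinder (n : nat) : set (set T) :=
  [set C | exists2 B : nat -> set R, (forall i, measurable (B i)) &
    C = [set w | forall i, (i < n)%N -> B i (X i w)]].


Lemma past_cylinder_setI n : setI_closed (past_cylinder n).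
Proof.
move=> _ _ [B1 mB1 ->] [B2 mB2 ->]; exists (fun i => B1 i `&` B2 i).
  by move=> i; exact: measurableI.
apply/seteqP; split => [w [h1 h2] i ni|w h]; first by split; [exact: h1|exact: h2].
by split => i ni; have [] := h i ni.
Qed.

Lemma past_cylinderT n : past_cylinder n setT.
Proof. by exists (fun=> setT) => //; apply/seteqP; split. Qed.

Lemma past_cylinder_bigcap n (B : nat -> set R) :
  [set w | forall i, (i < n)%N -> B i (X i w)] =
  \bigcap_(i in [set` [fset i in iota 0 n]%fset]) (X i @^-1` B i).
Proof.
apply/seteqP; split => w h i /=.
  by rewrite !inE/= mem_iota add0n/=; exact: h.
by move=> ni; apply: (h i); rewrite /= !inE/= mem_iota.
Qed.

Lemma past_cylinder_measurable n : past_cylinder n `<=` measurable.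
Proof.
move=> _ [B mB ->]; rewrite past_cylinder_bigcap; apply: fin_bigcap_measurable => //.
by move=> i _; rewrite -[_ @^-1` _]setTI; exact: measurable_funP.
Qed.

Lemma prob_past_cylinder n (B : nat -> set R) : (forall i, measurable (B i)) ->
  P [set w | forall i, (i < n)%N -> B i (X i w)] =
  (\prod_(i < n) P (X i @^-1` B i))%E.
Proof.
move=> mB; rewrite past_cylinder_bigcap X_indep//.
rewrite -(big_mkord xpredT (fun i => P (X i @^-1` B i))) /index_iota subn0.
apply: perm_big; apply: uniq_perm; rewrite ?fset_uniq ?iota_uniq// => i.
by rewrite !inE.
Qed.

Lemma past_cylinder_indep n C D : past_cylinder n C -> measurable D ->
  P (C `&` X n @^-1` D) = (P C * P (X n @^-1` D))%E.
Proof.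
move=> [B mB ->] mD; pose B' i := if i == n then D else B i.
have mB' i : measurable (B' i) by rewrite /B'; case: eqP.
rewrite [X in P X](_ : _ = [set w | forall i, (i < n.+1)%N -> B' i (X i w)]); last first.
  apply/seteqP; split => [w [h hD] i|w h].
    rewrite ltnS leq_eqVlt /B'; case: eqP => [->//|_ /=]; exact: h.
  split; last by have := h n (ltnSn n); rewrite /B' eqxx.
  by move=> i ni; have := h i (ltnW ni); rewrite /B' ltn_eqF.
rewrite !prob_past_cylinder// big_ord_recr/= /B' eqxx; congr (_ * _)%E.
by apply: eq_bigr => i _; rewrite ltn_eqF.
Qed.

Local Notation past n := (g_sigma_algebraType (past_cylinder n)).

Lemma past_measurable n (A : set (past n)) : measurable A -> d.-measurable (A : set T).
Proof. exact: (smallest_sub (@sigma_algebra_measurable _ T) (@past_cylinder_measurable n)). Qed.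

(** As functions of C both sides are finite measures that agree on the pi-system of cylinders, hence
    on the sigma-algebra it generates. *)
Lemma past_indep n (C : set (past n)) (D : set R) : measurable C -> measurable D ->
  P ((C : set T) `&` X n @^-1` D) = (P C * P (X n @^-1` D))%E.
Proof.
move=> mC mD.
have mXD : measurable (X n @^-1` D).
  by rewrite -[_ @^-1` _]setTI; exact: measurable_funP.
have pge0 : (0 <= fine (P (X n @^-1` D)))%R by exact: fine_ge0.
pose m1 := mrestr P mXD.
pose m2 := mscale (NngNum pge0) P.
have m2E A : m2 A = (P A * P (X n @^-1` D))%E.
  by rewrite /m2 /mscale/= fineK ?fin_num_measure// muleC.
transitivity (m1 C) => //; rewrite -m2E.
apply: (g_sigma_algebra_measure_unique (past_cylinder n) _ (fun=> setT)) => //.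
- exact: past_cylinder_measurable.
- by move=> _; exact: past_cylinderT.
- by rewrite bigcup_const.
- exact: past_cylinder_setI.
- by move=> A GA /=; rewrite -/m1 -/m2 [RHS]m2E [LHS]past_cylinder_indep.
- by move=> _ /=; rewrite /mrestr setTI (le_lt_trans (probability_le1 _ _))// ltry.
Qed.

Lemma past_id_measurable n : @measurable_fun _ _ T (past n) setT id.
Proof. by move=> _ A mA; rewrite setTI preimage_id; exact: past_measurable. Qed.

Lemma past_coord_measurable n i : (i < n)%N -> @measurable_fun _ _ (past n) R setT (X i).
Proof.
move=> ni _ B mB; rewrite setTI; apply: sub_sigma_algebra.
exists (fun j => if j == i then B else setT) => [j|]; first by case: eqP.
apply/seteqP; split => [w Bw j jn|w /(_ _ ni)]; last by rewrite eqxx.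
by case: eqP => [->|].
Qed.

Lemma past_le_measurable m n : (m <= n)%N ->
  @measurable_fun _ _ (past n) (past m) setT id.
Proof.
move=> mn _ A mA; rewrite setTI preimage_id.
apply: (smallest_sub _ _ mA); first exact: smallest_sigma_algebra.
move=> _ [B mB ->]; apply: sub_sigma_algebra.
exists (fun i => if (i < m)%N then B i else setT) => [i|]; first by case: ifP.
apply/seteqP; split => [w h i _|w h i im]; first by case: ifP => // im; exact: h.
by have := h i (leq_trans im mn); rewrite im.
Qed.

Lemma past_fun_le d' (T' : measurableType d') m n (f : T -> T') : (m <= n)%N ->
  @measurable_fun _ _ (past m) T' setT f -> @measurable_fun _ _ (past n) T' setT f.
Proof. by move=> mn mf; exact: (measurableT_comp mf (past_le_measurable mn)). Qed.

(** Freezing lemma: by [past_indep] the joint law of the past and X_n agrees with the product of the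
    marginals on rectangles, hence everywhere, and Tonelli integrates X_n out with the past held
    fixed. *)
Lemma past_integral n (psi : past n * R -> \bar R) :
  measurable_fun setT psi -> (forall z, 0 <= psi z)%E ->
  (\int[P]_w psi (w : past n, X n w) =
   \int[P]_w \int[distribution P (X n)]_x psi (w : past n, x))%E.
Proof.
move=> mpsi psi0.
pose idn : {mfun T >-> past n} :=
  HB.pack (id : T -> past n) (isMeasurableFun.Build _ _ _ _ _ (@past_id_measurable n)).
have mpair : measurable_fun setT (fun w : T => (w : past n, X n w)).
  by apply: measurable_fun_pair => //; exact: past_id_measurable.
pose pairn : {mfun T >-> (past n * R)%type} :=
  HB.pack (fun w : T => (w : past n, X n w)) (isMeasurableFun.Build _ _ _ _ _ mpair).
pose mu := distribution P pairn.
have muE A : measurable A -> (distribution P idn \x distribution P (X n))%E A = mu A.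
  apply: product_measure_unique => B D mB mD.
  by rewrite /mu /distribution /pushforward/= -past_indep.
transitivity (\int[mu]_z psi z)%E.
  by rewrite /mu /distribution ge0_integral_pushforward.
rewrite (eq_measure_integral (distribution P idn \x distribution P (X n))%E); last first.
  by move=> A mA _; exact/esym/muE.
rewrite fubini_tonelli1//= /distribution ge0_integral_pushforward//.
- exact: measurable_fun_fubini_tonelli_F.
- by move=> y _; exact: integral_ge0.
Qed.

End independent_sequence.

(** * Runs of i.i.d. observations below a level fixed by the past *)

Section independent_identically_distributed.
Context d (T : measurableType d) (R : realType) (P : probability T R).
Variables (X : nat -> {RV P >-> R}) (F : R -> R).
Hypothesis X_indep : mutually_independent X.
Hypothesis X_cdf : forall i x, cdf (X i) x = (F x)%:E.

Local Notation past n := (g_sigma_algebraType (past_cylinder X n)).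

Lemma cdf_fun_ge0 x : 0 <= F x.
Proof. by rewrite -lee_fin -(X_cdf 0); exact: cdf_ge0. Qed.

Lemma cdf_fun_le1 x : F x <= 1.
Proof. by rewrite -lee_fin -(X_cdf 0); exact: cdf_le1. Qed.

Lemma cdf_fun_measurable : measurable_fun setT F.
Proof.
apply/measurable_EFinP; rewrite (_ : EFin \o F = cdf (X 0)).
  exact: cdf_measurable.
by apply/funext => x /=; rewrite X_cdf.
Qed.

Lemma integral_gt_observation n (f z : T -> R) : (forall w, 0 <= f w) ->
  @measurable_fun _ _ (past n) R setT f -> @measurable_fun _ _ (past n) R setT z ->
  (\int[P]_w (f w * (z w < X n w)%R%:R)%:E =
   \int[P]_w (f w * (1 - F (z w)))%:E)%E.
Proof.
move=> f0 mf mz.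
pose psi (u : past n * R) := (f u.1 * (z u.1 < u.2)%R%:R)%:E.
transitivity (\int[P]_w psi (w : past n, X n w))%E => //.
rewrite past_integral//; last 2 first.
- apply/measurable_EFinP; apply: measurable_funM.
    exact: (measurableT_comp mf measurable_fst).
  apply: measurable_natr_bool; apply: measurable_fun_ltr => //.
  exact: (measurableT_comp mz measurable_fst).
- by move=> u; rewrite lee_fin mulr_ge0.
apply: eq_integral => w _; rewrite /psi/=.
under eq_integral do rewrite EFinM.
rewrite ge0_integralZl_EFin//; last first.
  by apply/measurable_EFinP; apply: measurable_natr_bool; exact: measurable_fun_ltr.
rewrite [RHS]EFinM; congr (_ * _)%E.
transitivity (\int[distribution P (X n)]_x (\1_(`]z w, +oo[%classic) x)%:E)%E.
  apply: eq_integral => x _; rewrite indicE.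
  by congr (_%:R%:E); rewrite mem_setE/= in_itv/= andbT.
rewrite integral_indic// setIT EFinB -(X_cdf n).
by rewrite -ccdf_1_cdf.
Qed.

Lemma integral_le_observation n (f c : T -> R) : (forall w, 0 <= f w) ->
  @measurable_fun _ _ (past n) R setT f -> @measurable_fun _ _ (past n) R setT c ->
  (\int[P]_w (f w * (X n w <= c w)%R%:R)%:E =
   \int[P]_w (f w * F (c w))%:E)%E.
Proof.
move=> f0 mf mc.
pose psi (u : past n * R) := (f u.1 * (u.2 <= c u.1)%R%:R)%:E.
transitivity (\int[P]_w psi (w : past n, X n w))%E => //.
rewrite past_integral//; last 2 first.
- apply/measurable_EFinP; apply: measurable_funM.
    exact: (measurableT_comp mf measurable_fst).
  apply: measurable_natr_bool; apply: measurable_fun_ler => //.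
  exact: (measurableT_comp mc measurable_fst).
- by move=> u; rewrite lee_fin mulr_ge0.
apply: eq_integral => w _; rewrite /psi/=.
under eq_integral do rewrite EFinM.
rewrite ge0_integralZl_EFin//; last first.
  by apply/measurable_EFinP; apply: measurable_natr_bool; exact: measurable_fun_ler.
rewrite [RHS]EFinM; congr (_ * _)%E.
transitivity (\int[distribution P (X n)]_x (\1_(`]-oo, c w]%classic) x)%:E)%E.
  apply: eq_integral => x _; rewrite indicE.
  by congr (_%:R%:E); rewrite mem_setE/= in_itv.
by rewrite integral_indic// setIT -(X_cdf n).
Qed.

Lemma observations_le_measurable t g (c : T -> R) :
  @measurable_fun _ _ (past t) R setT c ->
  @measurable_fun _ _ (past (t + g)) R setT
    (fun w => \prod_(i < g) (X (t + i)%N w <= c w)%R%:R).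
Proof.
move=> mc; apply: measurable_prod => i _; apply: measurable_natr_bool.
apply: measurable_fun_ler.
  by apply: past_coord_measurable; rewrite ltn_add2l.
exact: past_fun_le (leq_addr _ _) mc.
Qed.

(** The last observation is integrated out first; its factor [F (c w)] is known at time t and joins
    the weight, which is why the induction is over all [f]. *)
Lemma integral_le_observations t g (f c : T -> R) : (forall w, 0 <= f w) ->
  @measurable_fun _ _ (past t) R setT f -> @measurable_fun _ _ (past t) R setT c ->
  (\int[P]_w (f w * \prod_(i < g) (X (t + i)%N w <= c w)%R%:R)%:E =
   \int[P]_w (f w * F (c w) ^+ g)%:E)%E.
Proof.
move=> + + mc; elim: g f => [|g IH] f f0 mf.
  by apply: eq_integral => w _; rewrite big_ord0 expr0.
under eq_integral do rewrite big_ord_recr/= mulrA.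
rewrite (@integral_le_observation (t + g)%N); last 3 first.
- by move=> w; rewrite mulr_ge0// prodr_ge0.
- apply: measurable_funM; first exact: past_fun_le (leq_addr _ _) mf.
  exact: observations_le_measurable.
- exact: past_fun_le (leq_addr _ _) mc.
under eq_integral do rewrite mulrAC.
rewrite IH; last 2 first.
- by move=> w; rewrite mulr_ge0// cdf_fun_ge0.
- by apply: measurable_funM => //; exact: measurableT_comp cdf_fun_measurable mc.
by apply: eq_integral => w _; rewrite exprS mulrA.
Qed.

Lemma integral_waiting t g (f c z : T -> R) : (forall w, 0 <= f w) ->
  @measurable_fun _ _ (past t) R setT f -> @measurable_fun _ _ (past t) R setT c ->
  @measurable_fun _ _ (past t) R setT z ->
  (\int[P]_w (f w * (\prod_(i < g) (X (t + i)%N w <= c w)%R%:R) *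
               (z w < X (t + g)%N w)%R%:R)%:E =
   \int[P]_w (f w * F (c w) ^+ g * (1 - F (z w)))%:E)%E.
Proof.
move=> f0 mf mc mz.
rewrite integral_gt_observation; last 3 first.
- by move=> w; rewrite mulr_ge0// prodr_ge0.
- apply: measurable_funM; first exact: past_fun_le (leq_addr _ _) mf.
  exact: observations_le_measurable.
- exact: past_fun_le (leq_addr _ _) mz.
under eq_integral do rewrite mulrAC.
rewrite integral_le_observations//; first by apply: eq_integral => w _; rewrite mulrAC.
- by move=> w; rewrite mulr_ge0// subr_ge0 cdf_fun_le1.
- apply: measurable_funM => //; apply: measurable_funB => //.
  exact: measurableT_comp cdf_fun_measurable mz.
Qed.

(** Ensures that every threshold is exceeded later on. Staying below M from index n on costs at
    least g factors [F M] for each g, and these powers tend to 0. *)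
Lemma observations_unbounded : (forall x, F x < 1) ->
  {ae P, forall w, forall (n M : nat), exists2 i, (n <= i)%N & M%:R < X i w}.
Proof.

move=> F1; apply/ae_foralln => n; apply/ae_foralln => M.
pose N := [set w | forall i, (n <= i)%N -> X i w <= M%:R].
have mN : measurable N.
  rewrite (_ : N = \bigcap_(i in [set i | (n <= i)%N]) (X i @^-1` `]-oo, M%:R])).
    by apply: bigcap_measurableType => i _; rewrite -[_ @^-1` _]setTI; exact: measurable_funP.
  by apply/seteqP; split => w h i ni; have := h i ni; rewrite /preimage/= in_itv.
exists N; split => //; last first.
  move=> w /= nex i ni; rewrite leNgt; apply/negP => Xi.
  by apply: nex; exists i.
pose B i : set R := if (i < n)%N then setT else `]-oo, M%:R]%classic.
have PN g : (P N <= (F M%:R ^+ g)%:E)%E.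
  apply: (@le_trans _ _ (P [set w | forall i, (i < n + g)%N -> B i (X i w)])).
    apply: le_measure; rewrite ?inE//.
      apply: (@past_cylinder_measurable _ _ _ _ X (n + g)); exists B => // i.
      by rewrite /B; case: ifP.
    by move=> w Nw i _; rewrite /B; case: ltnP => //= ni; rewrite in_itv/= Nw.
  rewrite prob_past_cylinder//; last by move=> i; rewrite /B; case: ifP.
  rewrite big_split_ord/= big1 ?mul1e; last first.
    by move=> i _; rewrite /B ltn_ord preimage_setT probability_setT.
  rewrite (eq_bigr (fun=> (F M%:R)%:E)); last first.
    by move=> i _; rewrite /B ltnNge leq_addr/= -(X_cdf (n + i)).
  by rewrite prodEFin prodr_const card_ord.
apply/eqP; rewrite eq_le measure_ge0 andbT -[leLHS]fineK ?fin_num_measure//.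
have {}PN g : fine (P N) <= F M%:R ^+ g.
  by rewrite -lee_fin fineK ?fin_num_measure.
have cF : F M%:R ^+ g @[g --> \oo] --> (0 : R).
  by apply: cvg_expr; rewrite ger0_norm ?F1//; exact: cdf_fun_ge0.
by rewrite lee_fin; apply: (cvgr_to_ge cF); exact: nearW.
Qed.

End independent_identically_distributed.

(** * Selection times along a path *)

Lemma nneseries_ge_term (R : realType) (u : nat -> \bar R) k :
  (forall i, 0 <= u i)%E -> (u k <= \sum_(i <oo) u i)%E.
Proof.
move=> u0; apply: le_trans (nneseries_lim_ge k.+1 _); last by move=> *; exact: u0.
by rewrite big_nat_recr//= leeDr// sume_ge0.
Qed.

Lemma nneseries_le_bound (R : realType) (u : nat -> \bar R) (l : \bar R) :
  (forall i, 0 <= u i)%E -> (forall N, \sum_(0 <= i < N) u i <= l)%E ->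
  (\sum_(i <oo) u i <= l)%E.
Proof.
move=> u0 ul; apply: lime_le; first by apply: is_cvg_nneseries => *; exact: u0.
by apply: nearW => N; exact: ul.
Qed.

Section selection_paths.
Context {R : realType}.
Variable beta : R.
Implicit Types (x : nat -> R) (n t : nat).

(* Indices are shifted by one with respect to stages: [stime x n] is T_(n+1)
   and [smean x n] is the mean of Y_1, ..., Y_(n+1). *)
Definition stime x n : nat := (selection beta x n).1.
Definition ssum x n : R := (selection beta x n).2.
Definition smean x n : R := ssum x n / n.+1%:R.
Definition threshold x n : R := beta * smean x n.
Definition svalue x n : R := x (stime x n).-1.

Lemma stimeS x n :
  stime x n.+1 = next_exceedance x (threshold x n) (stime x n).
Proof. by rewrite /stime /threshold /smean /ssum /=; case: selection. Qed.

Lemma ssumS x n : ssum x n.+1 = ssum x n + svalue x n.+1.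
Proof. by rewrite /svalue /stime /ssum /=; case: selection. Qed.

(** The infimum becomes a finite Boolean test, from which measurability follows. Only positive
    values are described, so the junk value 0 never has to be tested. *)
Lemma next_exceedanceE x c t n : (next_exceedance x c t == n.+1) =
  [&& (t <= n)%N, c < x n & all (fun i => (t <= i)%N ==> (x i <= c)) (iota 0 n)].
Proof.
rewrite /next_exceedance; case: pselect => [ex_i|nex] /=.
  case: ex_minnP => m /andP[tm cm] mmin; apply/eqP/and3P => [mn|[tn cn /allP h]].
    move: tm cm mmin; rewrite {}mn => tn cn mmin; split => //.
    apply/allP => i; rewrite mem_iota add0n => /= ni; apply/implyP => ti.
    rewrite leNgt; apply/negP => ci; have := mmin i.+1.
    by rewrite ltnS ti ci => /(_ isT); rewrite ltnS leqNgt ni.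
  apply/eqP; rewrite eqn_leq mmin ?ltnS ?tn ?cn//=.
  rewrite leqNgt; apply/negP => mn; case: m tm cm mmin mn => // m tm cm mmin mn.
  have := h m; rewrite mem_iota add0n => /(_ mn)/implyP/(_ tm).
  by rewrite leNgt cm.
apply/esym/negP => /and3P[tn cn _]; apply: nex; exists n.+1.
by rewrite ltnS tn cn.
Qed.

(* Excludes the paths on which [next_exceedance] returns the junk value 0. *)
Definition increasing_stimes x n :=
  all (fun j => (stime x j < stime x j.+1)%N) (iota 0 n).

Lemma increasing_stimesS x n : increasing_stimes x n.+1 =
  increasing_stimes x n && (stime x n < stime x n.+1)%N.
Proof. by rewrite /increasing_stimes -addn1 iotaD add0n all_cat/= andbT addn1. Qed.

Lemma next_exceedance_local x x' c t :
  (t < next_exceedance x c t)%N ->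
  (forall i, (i < next_exceedance x c t)%N -> x i = x' i) ->
  next_exceedance x' c t = next_exceedance x c t.
Proof.
case E : next_exceedance => [//|u] _ xx'; apply/eqP; rewrite next_exceedanceE.
move/eqP : E; rewrite next_exceedanceE -!xx'// => /and3P[-> -> /allP h] /=.
apply/allP => i iu; rewrite -xx' ?h//.
by move: iu; rewrite mem_iota add0n => /= /ltnW.
Qed.

(** The stopping time property: the observations up to the last selection determine all selections
    so far. The increase of the times rules out the junk value, which would depend on the whole
    future. *)
Lemma selection_local x x' n : increasing_stimes x n ->
  (forall i, (i < stime x n)%N -> x i = x' i) ->
  forall j, (j <= n)%N -> selection beta x' j = selection beta x j.
Proof.
elim: n => [|n IH].
  by move=> _ xx' [|//] _ /=; rewrite xx'.
rewrite increasing_stimesS => /andP[vn lt] xx' j.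
have {}IH k : (k <= n)%N -> selection beta x' k = selection beta x k.
  by apply: IH => // i /ltn_trans => /(_ _ lt); exact: xx'.
rewrite leq_eqVlt => /orP[/eqP ->|]; last exact: IH.
have tt' : stime x' n.+1 = stime x n.+1.
  move: lt xx'; rewrite !stimeS /threshold /smean /ssum /stime IH// => lt xx'.
  exact: next_exceedance_local.
rewrite [LHS]surjective_pairing [RHS]surjective_pairing -/(ssum _ _) -/(stime _ _).
rewrite -/(ssum _ _) -/(stime _ _) tt' !ssumS /svalue tt'.
by rewrite /ssum IH// xx'// prednK// (leq_ltn_trans _ lt).
Qed.

(** The event on which the random time is replaced by the fixed time t; its first clause makes it
    decidable from the first t observations. *)
Definition arrival x n t := increasing_stimes x n && (stime x n == t).

(* A functional of the path is handled through its composites with arbitrary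
   families of measurable functions, so that the same statement applies to the
   observations and to their truncations, which are functions of the past. *)
Definition path_measurable {d'} {U : measurableType d'} (f : (nat -> R) -> U) :=
  forall (d : measure_display) (T : measurableType d) (x : nat -> T -> R),
    (forall i, measurable_fun setT (x i)) ->
    measurable_fun setT (fun w => f (x ^~ w)).

(** A pathwise substitute for measurability with respect to the sigma-algebra stopped at the
    selection time. *)
Definition depends_on_past {U : Type} n (f : (nat -> R) -> U) :=
  forall x x', increasing_stimes x n ->
    (forall i, (i < stime x n)%N -> x i = x' i) -> f x = f x'.

Lemma stime_past n j : (j <= n)%N -> depends_on_past n (stime ^~ j).
Proof. by move=> jn x x' vx xx'; rewrite /stime (selection_local vx xx'). Qed.

Lemma ssum_past n j : (j <= n)%N -> depends_on_past n (ssum ^~ j).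
Proof. by move=> jn x x' vx xx'; rewrite /ssum (selection_local vx xx'). Qed.

Lemma threshold_past n j : (j <= n)%N -> depends_on_past n (threshold ^~ j).
Proof. by move=> jn x x' vx xx'; rewrite /threshold /smean (ssum_past jn vx xx'). Qed.

Lemma arrival_past n t : depends_on_past n (fun x => arrival x n t).
Proof.
move=> x x' vx xx'; rewrite /arrival (stime_past (leqnn n) vx xx'); congr (_ && _).
apply: eq_in_all => j; rewrite mem_iota add0n => /= jn.
by rewrite (stime_past jn vx xx') (stime_past (ltnW jn) vx xx').
Qed.

Lemma measurable_all d (T : measurableType d) (b : nat -> T -> bool) (s : seq nat) :
  (forall i, measurable_fun setT (b i)) ->
  measurable_fun setT (fun w => all (b ^~ w) s).
Proof.
move=> mb; elim: s => [|i s IH] /=; first exact: measurable_cst.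
exact: measurable_and.
Qed.

Lemma measurable_implb d (T : measurableType d) (b c : T -> bool) :
  measurable_fun setT b -> measurable_fun setT c ->
  measurable_fun setT (fun w => b w ==> c w).
Proof.
move=> mb mc; rewrite (_ : (fun w => _) = (fun w => ~~ b w || c w)).
  by apply: measurable_or => //; exact: measurable_neg.
by apply/funext => w; rewrite implybE.
Qed.

(** The event [tau = 0] is the complement of all the others, which matches the form of
    [next_exceedanceE]. *)
Lemma measurable_natP d (T : measurableType d) (tau : T -> nat) :
  (forall n, measurable_fun setT (fun w => tau w == n.+1)) ->
  measurable_fun setT tau.
Proof.
move=> mtau.
have mS n : measurable [set w | tau w = n.+1].
  have := mtau n measurableT [set true] I.
  by rewrite setTI; congr measurable; apply/seteqP; split => w /= /eqP.
have m0 n : measurable [set w | tau w = n].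
  case: n => [|n]; last exact: mS.
  rewrite (_ : [set _ | _] = ~` \bigcup_n [set w | tau w = n.+1]).
    by apply: measurableC; exact: bigcupT_measurable.
  apply/seteqP; split => [w tw [n _ /=]|w h]; first by rewrite tw.
  by apply/eqP; rewrite -leqn0 leqNgt; apply/negP; case E : (tau w) => [//|n] _;
    apply: h; exists n.
move=> _ A _; rewrite setTI (_ : _ @^-1` _ = \bigcup_(n in A) [set w | tau w = n]).
  by apply: bigcup_measurable => n _.
apply/seteqP; split => [w Aw|w [n An /= tn]]; first by exists (tau w).
by rewrite /preimage/= tn.
Qed.

Lemma measurable_at_index d (T : measurableType d) (x : nat -> T -> R) (tau : T -> nat) :
  (forall i, measurable_fun setT (x i)) -> measurable_fun setT tau ->
  measurable_fun setT (fun w => x (tau w) w).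
Proof.
move=> mx mtau _ B mB; rewrite setTI.
rewrite (_ : _ @^-1` _ = \bigcup_n (tau @^-1` [set n] `&` x n @^-1` B)).
  apply: bigcupT_measurable => n; apply: measurableI.
    by rewrite -[_ @^-1` _]setTI; exact: mtau.
  by rewrite -[_ @^-1` _]setTI; exact: mx.
apply/seteqP; split => [w Bw|w [n _ [/= tn Bw]]]; first by exists (tau w).
by rewrite /preimage/= tn.
Qed.

Lemma selection_measurable n :
  path_measurable (stime ^~ n) /\ path_measurable (ssum ^~ n).
Proof.
elim: n => [|n [IHt IHs]].
  by split => d T x mx; [exact: measurable_cst|exact: mx].
have mt : path_measurable (stime ^~ n.+1).
  move=> d T x mx; apply: measurable_natP => m.
  have mthr : measurable_fun setT (fun w => threshold (x ^~ w) n).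
    by apply: measurable_funM => //; apply: measurable_funM => //; exact: IHs.
  have mti i : measurable_fun setT (fun w => stime (x ^~ w) n <= i)%N.
    by apply: measurable_fun_leq => //; exact: IHt.
  under eq_fun do rewrite stimeS next_exceedanceE.
  apply: measurable_and => //; apply: measurable_and.
    exact: measurable_fun_ltr.
  apply: measurable_all => i; apply: measurable_implb => //.
  exact: measurable_fun_ler.
split => // d T x mx; under eq_fun do rewrite ssumS.
apply: measurable_funD; first exact: IHs.
apply: (@measurable_at_index _ _ _ (fun w => (stime (x ^~ w) n.+1).-1)) => //.
by apply: (@measurableT_comp _ _ _ _ _ _ predn) => //; exact: mt.
Qed.

Lemma stime_measurable n : path_measurable (stime ^~ n).
Proof. by have [] := selection_measurable n. Qed.

Lemma ssum_measurable n : path_measurable (ssum ^~ n).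
Proof. by have [] := selection_measurable n. Qed.

Lemma stimer_measurable n : path_measurable (fun x => (stime x n)%:R : R).
Proof.
move=> d T x mx; have mnat : measurable_fun setT (fun k : nat => k%:R : R) by [].
exact: measurableT_comp mnat (stime_measurable _ mx).
Qed.

Lemma threshold_measurable n : path_measurable (threshold ^~ n).
Proof.
move=> d T x mx; apply: measurable_funM => //; apply: measurable_funM => //.
exact: ssum_measurable.
Qed.

Lemma svalue_measurable n : path_measurable (svalue ^~ n).
Proof.
move=> d T x mx.
apply: (@measurable_at_index _ _ _ (fun w => (stime (x ^~ w) n).-1)) => //.
by apply: (@measurableT_comp _ _ _ _ _ _ predn) => //; exact: stime_measurable.
Qed.

Lemma arrival_measurable n t : path_measurable (fun x => arrival x n t).
Proof.
move=> d T x mx; apply: measurable_and.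
  apply: measurable_all => j; apply: measurable_fun_ltn; exact: stime_measurable.
by apply: measurable_fun_eqn => //; exact: stime_measurable.
Qed.

End selection_paths.

(** * Geometric waiting times given the past *)

Section waiting_times.
Context d (T : measurableType d) (R : realType) (P : probability T R).
Variables (X : nat -> {RV P >-> R}) (F : R -> R) (beta : R).
Hypothesis X_indep : mutually_independent X.
Hypothesis X_cdf : forall i x, cdf (X i) x = (F x)%:E.

Let path w : nat -> R := X ^~ w.
Let truncated t w : nat -> R := fun i => if (i < t)%N then X i w else 0.
Local Notation past n := (g_sigma_algebraType (past_cylinder X n)).
Local Notation thr := (threshold beta).

Let truncated_measurable d' (U : measurableType d') t (f : (nat -> R) -> U) :
  path_measurable f -> @measurable_fun _ _ (past t) U setT (fun w => f (truncated t w)).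
Proof.
move=> mf; apply: (mf _ (past t : measurableType _) (fun i w => truncated t w i)) => i.
rewrite /truncated; case E : (i < t)%N; last exact: measurable_cst.
exact: past_coord_measurable.
Qed.

Let path_comp_measurable d' (U : measurableType d') (f : (nat -> R) -> U) :
  path_measurable f -> measurable_fun setT (fun w => f (path w)).
Proof. by move=> mf; exact: mf. Qed.

(** Both implications come from locality: whichever of the two paths arrives at time t, the other
    agrees with it up to t and therefore arrives as well. *)
Let arrival_truncated n t w :
  arrival beta (truncated t w) n t = arrival beta (path w) n t.
Proof.
apply/idP/idP => a; case/andP: (a) => v /eqP st.
  rewrite -(@arrival_past _ _ _ _ _ _ v) // => i; rewrite st /truncated => it.
  by rewrite it.
rewrite -(@arrival_past _ _ _ _ _ _ v) // => i; rewrite st /truncated => it.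
by rewrite it.
Qed.

Let arrival_truncated_fun (U : Type) n t w (f : (nat -> R) -> U) :
  depends_on_past beta n f -> arrival beta (path w) n t ->
  f (truncated t w) = f (path w).
Proof.
move=> fn /andP[v /eqP st]; apply/esym/(fn _ _ v) => i; rewrite st => it.
by rewrite /truncated it.
Qed.

(** On an arrival at t truncation changes neither [f], [z] nor the threshold, and the truncated
    versions are functions of the first t observations, so [integral_waiting] applies. *)
Lemma integral_stage n t g (f z : (nat -> R) -> R) :
  path_measurable f -> depends_on_past beta n f -> (forall x, 0 <= f x) ->
  path_measurable z -> depends_on_past beta n z ->
  (\int[P]_w ((arrival beta (path w) n t)%:R * f (path w) *
     (\prod_(i < g) (X (t + i)%N w <= thr (path w) n)%R%:R) *
     (z (path w) < X (t + g)%N w)%R%:R)%:E =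
   \int[P]_w ((arrival beta (path w) n t)%:R * f (path w) *
     F (thr (path w) n) ^+ g * (1 - F (z (path w))))%:E)%E.
Proof.
move=> mf lf f0 mz lz.
pose f' w := (arrival beta (truncated t w) n t)%:R * f (truncated t w).
have E (H H' : T -> R) : (forall w, arrival beta (path w) n t -> H w = H' w) ->
  (\int[P]_w (f' w * H w)%:E =
   \int[P]_w ((arrival beta (path w) n t)%:R * f (path w) * H' w)%:E)%E.
  move=> HH; apply: eq_integral => w _; rewrite /f' arrival_truncated.
  have [a|_] := boolP (arrival beta (path w) n t); last by rewrite !mul0r.
  by rewrite (arrival_truncated_fun lf a) HH.
have thrE w : arrival beta (path w) n t -> thr (truncated t w) n = thr (path w) n.
  by move=> a; rewrite (arrival_truncated_fun (threshold_past (leqnn n)) a).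
under eq_integral do rewrite -mulrA.
under [RHS]eq_integral do rewrite -mulrA.
rewrite -(E (fun w => (\prod_(i < g) (X (t + i)%N w <= thr (truncated t w) n)%R%:R) *
     (z (truncated t w) < X (t + g)%N w)%R%:R)); last first.
  by move=> w a; rewrite thrE// (arrival_truncated_fun lz a).
rewrite -(E (fun w => F (thr (truncated t w) n) ^+ g * (1 - F (z (truncated t w))))); last first.
  by move=> w a; rewrite thrE// (arrival_truncated_fun lz a).
under eq_integral do rewrite mulrA.
under [RHS]eq_integral do rewrite mulrA.
apply: integral_waiting => //.
- by move=> w; rewrite mulr_ge0.
- apply: measurable_funM; last exact: truncated_measurable.
  by apply: measurable_natr_bool; apply: (truncated_measurable (@arrival_measurable _ _ _ _)).
- by apply: (truncated_measurable (@threshold_measurable _ _ _)).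
- exact: truncated_measurable.
Qed.

Let term n t g (f z : (nat -> R) -> R) w : R :=
  (arrival beta (path w) n t)%:R * f (path w) *
     (\prod_(i < g) (X (t + i)%N w <= thr (path w) n)%R%:R) *
     (z (path w) < X (t + g)%N w)%R%:R.

Let term_ge0 n t g f z w : (forall x, 0 <= f x) -> 0 <= term n t g f z w.
Proof. by move=> f0; rewrite /term !mulr_ge0// prodr_ge0. Qed.

(** For t the current time and g the gap minus one, minimality of the next exceedance makes all g
    failure indicators equal to 1. This single term of the double series over t and g already
    dominates [Psi]. *)
Let term_arrival n f z w : increasing_stimes beta (path w) n.+1 ->
  let t := stime beta (path w) n in
  let g := (stime beta (path w) n.+1 - stime beta (path w) n).-1 in
  term n t g f z w =
    f (path w) * (z (path w) < svalue beta (path w) n.+1)%R%:R.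
Proof.
rewrite increasing_stimesS => /andP[v]; rewrite /term /arrival v eqxx mul1r /svalue.
case E : (stime _ _ n.+1) => [//|u]; rewrite ltnS => tu /=.
move/eqP : E; rewrite stimeS next_exceedanceE => /and3P[_ _ /allP h].
rewrite subSn//= subnKC// big1 ?mulr1// => i _.
have := h (stime beta (path w) n + i)%N; rewrite mem_iota add0n leq_addr/=.
by rewrite -ltn_subRL => /(_ (ltn_ord i)); rewrite /path => ->.
Qed.

(* Given the past, the gap G = T_(n+2) - T_(n+1) is geometric with failure
   probability F (thr x n). Only an upper bound [h] on the partial sums of the
   conditional expectation is asked for: in the applications these partial sums
   are bounded by induction, without summing a series. *)
Lemma integral_waiting_le n (f : nat -> (nat -> R) -> R) (z h Psi : (nat -> R) -> R) :
  (forall g, path_measurable (f g)) -> (forall g, depends_on_past beta n (f g)) ->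
  (forall g x, 0 <= f g x) ->
  path_measurable z -> depends_on_past beta n z ->
  path_measurable h -> (forall x, 0 <= h x) ->
  path_measurable Psi -> (forall x, 0 <= Psi x) ->
  (forall x, increasing_stimes beta x n.+1 ->
    Psi x <= f (stime beta x n.+1 - stime beta x n).-1 x *
             (z x < svalue beta x n.+1)%R%:R) ->
  (forall x N, \sum_(0 <= g < N) f g x * F (thr x n) ^+ g * (1 - F (z x)) <= h x) ->
  {ae P, forall w, increasing_stimes beta (path w) n.+1} ->
  (\int[P]_w (Psi (path w))%:E <= \int[P]_w (h (path w))%:E)%E.
Proof.
move=> mf lf f0 mz lz mh h0 mPsi Psi0 Psif fh incr.
have mterm t g : measurable_fun setT (fun w => (term n t g (f g) z w)%:E).
  apply/measurable_EFinP; rewrite /term.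
  apply: measurable_funM; [apply: measurable_funM; [apply: measurable_funM|]|].
  - by apply: measurable_natr_bool; apply: (path_comp_measurable (@arrival_measurable _ _ _ _)).
  - exact: path_comp_measurable.
  - apply: measurable_prod => i _; apply: measurable_natr_bool.
    apply: measurable_fun_ler => //.
    by apply: (path_comp_measurable (@threshold_measurable _ _ _)).
  - apply: measurable_natr_bool; apply: measurable_fun_ltr => //.
    exact: path_comp_measurable.
have mseries t : measurable_fun setT (fun w => \sum_(g <oo) (term n t g (f g) z w)%:E)%E.
  by apply: ge0_emeasurable_sum => // g w _; rewrite lee_fin term_ge0.
apply: (@le_trans _ _
    (\int[P]_w (\sum_(t <oo) \sum_(g <oo) (term n t g (f g) z w)%:E))%E).
  apply: ae_ge0_le_integral => //.
  - by move=> w _; rewrite lee_fin.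
  - by apply/measurable_EFinP; exact: path_comp_measurable.
  - move=> w _; apply: nneseries_ge0 => t _ _; apply: nneseries_ge0 => g _ _.
    by rewrite lee_fin term_ge0.
  - apply: ge0_emeasurable_sum => // t w _ _.
    by apply: nneseries_ge0 => g _ _; rewrite lee_fin term_ge0.
  apply: filterS incr => w incr _.
  pose t := stime beta (path w) n.
  pose g := (stime beta (path w) n.+1 - stime beta (path w) n).-1.
  apply: (@le_trans _ _ (term n t g (f g) z w)%:E).
    by rewrite lee_fin term_arrival// Psif.
  apply: (@le_trans _ _ (\sum_(g <oo) (term n t g (f g) z w)%:E)%E).
    apply: (@nneseries_ge_term _ (fun g => (term n t g (f g) z w)%:E) g) => k.
    by rewrite lee_fin term_ge0.
  apply: (@nneseries_ge_term _ (fun t => \sum_(g <oo) (term n t g (f g) z w)%:E)%E t) => k.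
  by apply: nneseries_ge0 => l _ _; rewrite lee_fin term_ge0.
rewrite integral_nneseries//; last first.
  by move=> t w _; apply: nneseries_ge0 => g _ _; rewrite lee_fin term_ge0.
have marr t : measurable_fun setT
    (fun w => ((arrival beta (path w) n t)%:R * h (path w))%:E).
  apply/measurable_EFinP; apply: measurable_funM; last exact: path_comp_measurable.
  by apply: measurable_natr_bool; apply: (path_comp_measurable (@arrival_measurable _ _ _ _)).
apply: (@le_trans _ _
    (\sum_(t <oo) \int[P]_w ((arrival beta (path w) n t)%:R * h (path w))%:E)%E).
  apply: lee_nneseries => [t _ _|t _].
    apply: integral_ge0 => w _; apply: nneseries_ge0 => g _ _.
    by rewrite lee_fin term_ge0.
  rewrite integral_nneseries//; last by move=> g w _; rewrite lee_fin term_ge0.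
  apply: nneseries_le_bound => [g|N].
    by apply: integral_ge0 => w _; rewrite lee_fin term_ge0.
  under eq_bigr do rewrite integral_stage//.
  rewrite -ge0_integral_sum//; last 2 first.
  - move=> g; apply/measurable_EFinP.
    apply: measurable_funM; [apply: measurable_funM; [apply: measurable_funM|]|].
    + by apply: measurable_natr_bool; apply: (path_comp_measurable (@arrival_measurable _ _ _ _)).
    + exact: path_comp_measurable.
    + apply: measurable_funX; apply: (measurableT_comp (cdf_fun_measurable X_cdf)).
      by apply: (path_comp_measurable (@threshold_measurable _ _ _)).
    + apply: measurable_funB => //; apply: (measurableT_comp (cdf_fun_measurable X_cdf)).
      exact: path_comp_measurable.
  - move=> g w _; rewrite lee_fin !mulr_ge0 ?exprn_ge0 ?subr_ge0//.
      exact: cdf_fun_ge0 X_cdf _.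
    exact: cdf_fun_le1 X_cdf _.
  apply: ge0_le_integral => //.
  - move=> w _; apply: sume_ge0 => g _.
    rewrite lee_fin !mulr_ge0 ?exprn_ge0 ?subr_ge0//.
      exact: cdf_fun_ge0 X_cdf _.
    exact: cdf_fun_le1 X_cdf _.
  - apply: emeasurable_sum => g; apply/measurable_EFinP.
    apply: measurable_funM; [apply: measurable_funM; [apply: measurable_funM|]|].
    + by apply: measurable_natr_bool; apply: (path_comp_measurable (@arrival_measurable _ _ _ _)).
    + exact: path_comp_measurable.
    + apply: measurable_funX; apply: (measurableT_comp (cdf_fun_measurable X_cdf)).
      by apply: (path_comp_measurable (@threshold_measurable _ _ _)).
    + apply: measurable_funB => //; apply: (measurableT_comp (cdf_fun_measurable X_cdf)).
      exact: path_comp_measurable.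
  move=> w _; rewrite sumEFin lee_fin.
  under eq_bigr do rewrite -!mulrA.
  rewrite -mulr_sumr ler_wpM2l//.
  by under eq_bigr do rewrite mulrA; exact: fh.
apply: nneseries_le_bound => [t|N].
  by apply: integral_ge0 => w _; rewrite lee_fin mulr_ge0.
rewrite -ge0_integral_sum//; last by move=> t w _; rewrite lee_fin mulr_ge0.
apply: ge0_le_integral => //.
- by move=> w _; apply: sume_ge0 => t _; rewrite lee_fin mulr_ge0.
- exact: emeasurable_sum.
- by apply/measurable_EFinP; exact: path_comp_measurable.
move=> w _; rewrite sumEFin lee_fin -mulr_suml ler_piMl//.
(* Arrivals at different t are disjoint, so summing over t costs nothing. *)
suff -> : \sum_(0 <= t < N) (arrival beta (path w) n t)%:R =
    (increasing_stimes beta (path w) n && (stime beta (path w) n < N)%N)%:R :> R.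
  by rewrite lern1 leq_b1.
elim: N => [|N IH]; first by rewrite big_geq// andbF.
rewrite big_nat_recr//= IH /arrival.
case: increasing_stimes; rewrite ?addr0//= ltnS.
by case: (ltngtP (stime beta (path w) n) N); rewrite ?addr0 ?add0r.
Qed.

End waiting_times.

(** * Real estimates *)

Section real_estimates.
Context {R : realType}.
Implicit Types (x y p q : R) (n : nat).

(** Put y = q u and raise u <= 1 + u <= e^u to the power q. *)
Lemma powR_le_expR q y : 0 < q -> 0 <= y -> y `^ q <= q `^ q * expR y.
Proof.
move=> q0 y0; have yE : y = q * (y / q) by rewrite mulrCA divff ?mulr1// gt_eqF.
have yq0 : 0 <= y / q by rewrite divr_ge0// ltW.
rewrite [in leLHS]yE powRM ?(ltW q0)// ler_wpM2l ?powR_ge0//.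
rewrite [in leRHS]yE [q * _]mulrC expRM ge0_ler_powR ?nnegrE ?expR_ge0 ?(ltW q0)//.
by apply: le_trans (expR_ge1Dx _); rewrite lerDr.
Qed.

Lemma expRN_le_powR q y : 0 < q -> 0 < y -> expR (- y) <= q `^ q * y `^ (- q).
Proof.
move=> q0 y0; rewrite expRN powRN -ler_pdivrMr ?invr_gt0 ?powR_gt0// invrK.
by rewrite ler_pdivrMl ?expR_gt0// mulrC powR_le_expR// ltW.
Qed.

Lemma ln1D_ge x : 0 <= x -> x / (1 + x) <= ln (1 + x).
Proof.
move=> x0; have x1 : 0 < 1 + x by rewrite ltr_pwDl.
have -> : ln (1 + x) = - ln (1 - x / (1 + x)).
  rewrite (_ : 1 - x / (1 + x) = (1 + x)^-1); first by rewrite lnV ?opprK ?posrE.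
  by field; rewrite gt_eqF.
rewrite lerNr; apply: le_ln1Dx.
by rewrite ltrNl opprK ltr_pdivrMr// mul1r ltrDr.
Qed.

Lemma powR1D_ge x p : 0 <= x -> 0 <= p -> 1 + p * (x / (1 + x)) <= (1 + x) `^ p.
Proof.
move=> x0 p0; rewrite /powR gt_eqF ?ltr_pwDl//.
apply: le_trans (expR_ge1Dx _).
by rewrite lerD2l ler_wpM2l// ln1D_ge.
Qed.

Lemma powR1D_le x p : 0 <= x -> 0 <= p -> (1 + x) `^ p <= expR (p * x).
Proof.
move=> x0 p0; rewrite /powR gt_eqF ?ltr_pwDl// ler_expR ler_wpM2l//.
by apply: le_ln1Dx; rewrite (lt_le_trans _ x0)// ltrN10.
Qed.

Lemma powR_natrB1 n p : n.+1%:R `^ (p - 1) = n.+1%:R `^ p / n.+1%:R :> R.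
Proof.
by rewrite powRB ?powRr1//; apply/implyP => _; rewrite gt_eqF.
Qed.

(** Write t^p = t t^(p-1) with t = n + 2: the power t^(p-1) is nonincreasing in t and at most 1. *)
Lemma powR_succ_le_add1 n p : 0 <= p <= 1 ->
  n.+2%:R `^ p <= n.+1%:R `^ p + 1 :> R.
Proof.
move=> /andP[p0 p1].
have [->|pn0] := eqVneq p 0; first by rewrite !powRr0 lerDl.
have pp : 0 < p by rewrite lt_neqAle eq_sym pn0.
have n1 : 1 <= n.+1%:R :> R by rewrite ler1n.
have h m : m.+1%:R `^ p = m.+1%:R * m.+1%:R `^ (p - 1) :> R.
  by rewrite mulr_powRB1.
rewrite h -natr1 mulrDl mul1r lerD//.
  rewrite natr1 [leRHS]h ler_wpM2l// -!(opprB 1 p) !powRN lef_pV2 ?posrE ?powR_gt0//.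
  by rewrite ge0_ler_powR ?nnegrE ?subr_ge0// ler_nat.
by rewrite natr1 -(opprB 1 p) powRN invf_le1 ?powR_gt0// -[leLHS](powRr0 n.+2%:R);
  rewrite ler_powR ?subr_ge0// ler1n.
Qed.

(** Turns an eventual bound into a global one by adding the finitely many initial ratios to the
    constant. *)
Lemma ge_term_bound (u w : nat -> R) (n0 : nat) (C : R) :
  (forall n, 0 < w n) -> (forall n, (n0 <= n)%N -> u n <= C * w n) ->
  exists2 C', 0 < C' & forall n, u n <= C' * w n.
Proof.
move=> w0 uC.
pose C' := `|C| + 1 + \sum_(i < n0) `|u i / w i|.
have s0 k : 0 <= \sum_(i < k) `|u i / w i| by apply: sumr_ge0.
exists C'; first by rewrite /C' ltr_pwDl ?ltr_wpDl.
move=> n; have [n0n|nn0] := leqP n0 n.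
  apply: (le_trans (uC n n0n)); rewrite ler_pM2r// /C' -addrA.
  by rewrite (le_trans (ler_norm _))// lerDl addr_ge0.
rewrite -ler_pdivrMr// (le_trans (ler_norm _))// /C'.
rewrite (bigD1 (Ordinal nn0))//= addrCA lerDl addr_ge0//.
by apply: sumr_ge0.
Qed.

Lemma powR_natr_ge p (M : R) : 0 < p -> exists n0, forall n, (n0 <= n)%N ->
  M <= n.+1%:R `^ p.
Proof.
move=> p0; pose M1 := `|M| + 1.
have M0 : 0 < M1 by rewrite ltr_wpDl.
exists (Num.truncn (M1 `^ p^-1)) => n h.
have h1 : M1 `^ p^-1 <= n.+1%:R.
  by rewrite (le_trans (ltW (truncnS_gt _)))// ler_nat.
have : (M1 `^ p^-1) `^ p <= n.+1%:R `^ p.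
  by rewrite ge0_ler_powR ?nnegrE ?powR_ge0// ltW.
rewrite -powRrM mulVf ?gt_eqF// powRr1 ?(ltW M0)//; apply: le_trans.
by rewrite (le_trans (ler_norm _))// lerDl.
Qed.

Lemma powR_series_bounded p : 1 < p ->
  exists C : R, forall N, \sum_(0 <= n < N) n.+1%:R `^ (- p) <= C.
Proof.
move=> p1; have [s s0 ->] : exists2 s, 0 < s & p = s + 1.
  by exists (p - 1); rewrite ?subr_gt0// subrK.
(* The series is compared with a telescoping one. After division by t^-s the difference is at least
   s/(t+1+s), and t + 1 + s <= (2 + s) t for t >= 1 gives the constant. *)
have step n : n.+1%:R `^ (- (s + 1)) <= ((2 + s) / s) *
    (n.+1%:R `^ (- s) - n.+2%:R `^ (- s)) :> R.
  have n1 : (1 : R) <= n.+1%:R by rewrite ler1n.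
  rewrite -[n.+2%:R]natr1; move: (n.+1%:R) n1 => t t1.
  have t0 : 0 < t by rewrite (lt_le_trans _ t1).
  have -> : t `^ (- (s + 1)) = t `^ (- s) * t^-1 :> R.
    rewrite -powR_inv1 ?ltW// -powRD; first by congr (_ `^ _); ring.
    by apply/implyP => _; rewrite gt_eqF.
  have -> : t + 1 = t * (1 + t^-1) :> R.
    by rewrite mulrDr mulr1 divff ?gt_eqF.
  rewrite powRM ?addr_ge0 ?invr_ge0 ?(ltW t0)//.
  rewrite -[X in X - _]mulr1 -mulrBr [leRHS]mulrCA ler_wpM2l ?powR_ge0//.
  have : 1 + s * (t^-1 / (1 + t^-1)) <= (1 + t^-1) `^ s.
    by rewrite powR1D_ge ?invr_ge0 ?ltW.
  have -> : t^-1 / (1 + t^-1) = (t + 1)^-1.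
    by field; rewrite !gt_eqF// ?addr_gt0.
  move=> hs; rewrite powRN.
  have b0 : 0 < 1 + s / (t + 1) by rewrite ltr_pwDl ?divr_ge0 ?addr_ge0 ?(ltW t0) ?(ltW s0).
  apply: (@le_trans _ _ ((2 + s) / s * (1 - (1 + s / (t + 1))^-1))); last first.
    rewrite ler_wpM2l ?divr_ge0 ?addr_ge0 ?(ltW s0)// lerD2l lerN2.
    by rewrite lef_pV2// posrE// (lt_le_trans b0).
  have -> : 1 - (1 + s / (t + 1))^-1 = s / (t + 1 + s).
    by field; rewrite !gt_eqF// ?addr_gt0.
  rewrite mulrA divfK ?gt_eqF// ler_pdivlMr ?addr_gt0// ler_pdivrMl//.
  nra.
exists ((2 + s) / s) => N; apply: (@le_trans _ _ ((2 + s) / s * (1 - N.+1%:R `^ (- s)))).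
  elim: N => [|N IH]; first by rewrite big_geq// powR1 subrr mulr0.
  rewrite big_nat_recr//= (le_trans (lerD IH (step N)))// -mulrDr.
  by rewrite ler_wpM2l ?divr_ge0 ?addr_ge0 ?(ltW s0)// addrA subrK.
by rewrite ler_piMr ?divr_ge0 ?addr_ge0 ?(ltW s0)// lerBlDr lerDl powR_ge0.
Qed.

(** First-step analysis: a geometric variable equals 1 with probability 1/a, and otherwise restarts
    with x replaced by x + 1. The bound x + a satisfies this recursion exactly. *)
Lemma geometric_sum1_le (a x : R) N : 1 <= a -> 0 <= x ->
  \sum_(0 <= g < N) (x + g.+1%:R) * (1 - a^-1) ^+ g * a^-1 <= x + a.
Proof.
move=> a1; have a0 : 0 < a by rewrite (lt_le_trans _ a1).
elim: N x => [|N IH] x x0; first by rewrite big_geq// addr_ge0// ltW.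
rewrite big_nat_recl//= expr0 mulr1.
have q0 : 0 <= 1 - a^-1 by rewrite subr_ge0 invf_le1.
have := IH (x + 1); rewrite addr_ge0// => /(_ isT) h.
apply: (@le_trans _ _ ((x + 1) * a^-1 + (1 - a^-1) * (x + 1 + a))).
  rewrite lerD2l; apply: le_trans (ler_wpM2l q0 h).
  rewrite mulr_sumr ler_sum// => g _; rewrite [_ ^+ g.+1]exprS -natr1.
  by rewrite le_eqVlt; apply/orP; left; apply/eqP; ring.
by rewrite le_eqVlt; apply/orP; left; apply/eqP; field; rewrite gt_eqF.
Qed.

(* For G geometric of mean a, E (x + G)^2 = (x + a)^2 + a^2 - a. *)
Lemma geometric_sum2_le (a x : R) N : 1 <= a ->
  \sum_(0 <= g < N) (x + g.+1%:R) ^+ 2 * (1 - a^-1) ^+ g * a^-1 <=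
  (x + a) ^+ 2 + a ^+ 2.
Proof.
move=> a1; have a0 : 0 < a by rewrite (lt_le_trans _ a1).
(* With the exact variance a^2 - a the first-step recursion is an identity. *)
suff : \sum_(0 <= g < N) (x + g.+1%:R) ^+ 2 * (1 - a^-1) ^+ g * a^-1 <=
    (x + a) ^+ 2 + (a ^+ 2 - a).
  by move=> /le_trans; apply; rewrite lerD2l lerBlDr lerDl ltW.
elim: N x => [|N IH] x.
  by rewrite big_geq// addr_ge0 ?sqr_ge0// subr_ge0 expr2 ler_peMl// ltW.
rewrite big_nat_recl//= expr0 mulr1.
have q0 : 0 <= 1 - a^-1 by rewrite subr_ge0 invf_le1.
apply: (@le_trans _ _ ((x + 1) ^+ 2 * a^-1 +
    (1 - a^-1) * ((x + 1 + a) ^+ 2 + (a ^+ 2 - a)))).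
  rewrite lerD2l; apply: le_trans (ler_wpM2l q0 (IH (x + 1))).
  rewrite mulr_sumr ler_sum// => g _; rewrite [_ ^+ g.+1]exprS -natr1.
  by rewrite le_eqVlt; apply/orP; left; apply/eqP; ring.
by rewrite le_eqVlt; apply/orP; left; apply/eqP; field; rewrite gt_eqF.
Qed.

End real_estimates.

(** * Growth of the running mean *)

Section growth.
Context {R : realType}.
Variables (alpha beta : R) (m y : nat -> R).
Hypotheses (alpha0 : 0 < alpha) (beta1 : 1 < beta).
Hypothesis m0_gt0 : 0 < m 0%N.
Hypothesis mS : forall n, m n.+1 = (m n * n.+1%:R + y n.+1) / n.+2%:R.
Hypothesis y_ge : forall n, beta * m n <= y n.+1.

Let gamma := alpha * (beta - 1).
Let L n := (beta * m n) `^ alpha.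

Let beta_gt0 : 0 < beta. Proof. exact: lt_trans beta1. Qed.
Let beta10 : 0 < beta - 1. Proof. by rewrite subr_gt0. Qed.
Let gamma_gt0 : 0 < gamma. Proof. exact: mulr_gt0. Qed.

Lemma mean_step_ge n : 0 <= m n -> m n * (1 + (beta - 1) / n.+2%:R) <= m n.+1.
Proof.
move=> mn; rewrite mS ler_pdivlMr// -mulrA.
have -> : (1 + (beta - 1) / n.+2%:R) * n.+2%:R = n.+1%:R + beta.
  by rewrite mulrDl mul1r divfK// -[n.+2%:R]natr1; ring.
by rewrite mulrDr lerD2l mulrC.
Qed.

(** The shift by [beta] makes the induction exact: with x = (beta-1)/(n+2), the bound ln(1+x) >=
    x/(1+x) = (beta-1)/(n+1+beta) is precisely the exponent that bounds the growth of the left-hand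
    side. *)
Lemma mean_lower n :
  m 0%N * ((n.+1%:R + beta) / (1 + beta)) `^ (beta - 1) <= m n.
Proof.
elim: n => [|n IH]; first by rewrite divff ?gt_eqF ?addr_gt0// powR1 mulr1.
have t0 : (0 : R) <= n.+1%:R by [].
have tb : 0 < n.+1%:R + beta by rewrite ltr_wpDl.
have mn0 : 0 <= m n.
  by apply: le_trans IH; rewrite mulr_ge0 ?powR_ge0// ltW.
apply: le_trans (mean_step_ge mn0).
have -> : (n.+2%:R + beta) / (1 + beta) =
    (n.+1%:R + beta) / (1 + beta) * (1 + (n.+1%:R + beta)^-1).
  by rewrite -[n.+2%:R]natr1; field; rewrite !gt_eqF// addr_gt0.
rewrite powRM ?addr_ge0 ?invr_ge0 ?divr_ge0 ?addr_ge0 ?(ltW beta_gt0)//.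
rewrite mulrA ler_pM// ?mulr_ge0 ?powR_ge0 ?(ltW m0_gt0)//.
apply: (le_trans (powR1D_le _ _)); rewrite ?invr_ge0 ?(ltW tb) ?(ltW beta10)//.
have x0 : 0 <= (beta - 1) / n.+2%:R by rewrite divr_ge0// ltW.
rewrite -[leRHS](@lnK _) ?posrE ?ltr_pwDl// ler_expR.
apply: le_trans (ln1D_ge x0); rewrite -(natr1 n.+1).
move: (n.+1%:R) t0 tb => t t0 tb.
rewrite le_eqVlt; apply/orP; left; apply/eqP; field.
by do ?[apply/andP; split]; apply: lt0r_neq0; lra.
Qed.

Lemma mean_gt0 n : 0 < m n.
Proof.
apply: lt_le_trans (mean_lower n); rewrite mulr_gt0// powR_gt0//.
by rewrite divr_gt0 ?ltr_wpDl// ltW.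
Qed.

Lemma hazard_lower n :
  (beta * m 0%N / (1 + beta) `^ (beta - 1)) `^ alpha * n.+1%:R `^ gamma <= L n.
Proof.
have b1 : 0 < 1 + beta by rewrite addr_gt0.
rewrite /gamma [alpha * _]mulrC powRrM -powRM ?powR_ge0//; last first.
  by rewrite divr_ge0 ?powR_ge0// mulr_ge0// ltW.
apply: ge0_ler_powR; rewrite ?nnegrE ?(ltW alpha0)//.
- by rewrite mulr_ge0 ?powR_ge0// divr_ge0 ?powR_ge0// mulr_ge0// ltW.
- by rewrite mulr_ge0// ltW// mean_gt0.
rewrite -!mulrA ler_pM2l//; apply: le_trans (mean_lower n); rewrite ler_pM2l//.
rewrite powRM ?invr_ge0 ?(ltW b1) ?addr_ge0 ?(ltW beta_gt0)//.
have -> : (1 + beta)^-1 `^ (beta - 1) = ((1 + beta) `^ (beta - 1))^-1.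
  by rewrite -powRN -(powR_inv1 (ltW b1)) -powRrM mulN1r.
rewrite mulrC ler_wpM2r ?invr_ge0 ?powR_ge0// ge0_ler_powR ?nnegrE ?(ltW beta10)//.
  by rewrite addr_ge0// ltW.
by rewrite lerDl ltW.
Qed.

Lemma hazard_gt0 n : 0 < L n.
Proof. by rewrite powR_gt0// mulr_gt0// mean_gt0. Qed.

(** One step multiplies [L n] by at least (1+x)^alpha, with x as in [mean_step_ge]. The bound
    [powR1D_ge], valid for every positive exponent, makes the relative gain of order gamma/n, and
    [hazard_lower] supplies the size of [L n]. *)
Lemma hazard_increment_lower : exists2 c, 0 < c &
  forall n, c * n.+1%:R `^ (gamma - 1) <= L n.+1 - L n.
Proof.
set c0 := (beta * m 0%N / (1 + beta) `^ (beta - 1)) `^ alpha.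
have c00 : 0 < c0.
  by rewrite powR_gt0// divr_gt0 ?powR_gt0 ?mulr_gt0// addr_gt0.
exists (c0 * (gamma / (1 + beta))).
  by rewrite mulr_gt0// divr_gt0 ?addr_gt0.
move=> n; have t1 : (1 : R) <= n.+1%:R by rewrite ler1n.
have t0 : (0 : R) < n.+1%:R by [].
have [x x0 xE] : exists2 x, 0 <= x & x = (beta - 1) / n.+2%:R.
  by exists ((beta - 1) / n.+2%:R) => //; rewrite divr_ge0// ltW.
have h1 : L n * (1 + x) `^ alpha <= L n.+1.
  rewrite /L -powRM ?addr_ge0 ?mulr_ge0 ?(ltW beta_gt0) ?(ltW (mean_gt0 n))//.
  apply: ge0_ler_powR; rewrite ?nnegrE ?(ltW alpha0)//.
  - by rewrite !mulr_ge0 ?addr_ge0 ?(ltW beta_gt0) ?(ltW (mean_gt0 n)).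
  - by rewrite mulr_ge0// ltW// mean_gt0.
  - by rewrite xE -mulrA ler_pM2l// mean_step_ge// ltW// mean_gt0.
have h2 : gamma / (1 + beta) / n.+1%:R <= (1 + x) `^ alpha - 1.
  rewrite lerBrDl; apply: le_trans (powR1D_ge x0 (ltW alpha0)); rewrite lerD2l.
  have -> : x / (1 + x) = (beta - 1) / (n.+1%:R + beta).
    have b0 := beta_gt0; rewrite xE -(natr1 n.+1).
    move: (n.+1%:R) t0 => t t0; field.
    by do ?[apply/andP; split]; apply: lt0r_neq0; lra.
  rewrite /gamma -!mulrA !ler_pM2l// -invfM lef_pV2 ?posrE ?mulr_gt0 ?addr_gt0//.
  by rewrite mulrDl mul1r lerD2l ler_peMr// ltW.
apply: (@le_trans _ _ (L n * (gamma / (1 + beta) / n.+1%:R))); last first.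
  apply: (@le_trans _ _ (L n * ((1 + x) `^ alpha - 1))).
    by rewrite ler_pM2l ?hazard_gt0.
  by rewrite mulrBr mulr1 lerD2r.
rewrite [leRHS]mulrCA mulrAC [leLHS]mulrC ler_pM2l; last first.
  by rewrite divr_gt0 ?addr_gt0.
rewrite [leLHS](_ : _ = (c0 * n.+1%:R `^ gamma) / n.+1%:R).
  by rewrite ler_pM2r ?invr_gt0// hazard_lower.
by rewrite powR_natrB1 mulrA.
Qed.

(** One step multiplies [L n] by at most exp(g/(n+2)), which is below (1+1/(n+1))^g; this gives
    [L n] of order n^g, and the increment follows from [L n] times the relative gain. *)
Lemma hazard_increment_upper (beta' : R) n0 :
  beta <= beta' -> alpha * (beta' - 1) <= 1 ->
  (forall n, (n0 <= n)%N -> y n.+1 <= beta' * m n) ->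
  exists2 C, 0 < C &
  forall n, L n.+1 - L n <= C * n.+1%:R `^ (alpha * (beta' - 1) - 1).
Proof.
move=> bb' g1 yle; set g := alpha * (beta' - 1) in g1 *.
have b'0 : 0 < beta' - 1 by rewrite subr_gt0 (lt_le_trans beta1).
have g0 : 0 < g by rewrite mulr_gt0.
have step n : (n0 <= n)%N -> L n.+1 <= L n * expR (g / n.+2%:R).
  move=> n0n; have x0 : 0 <= (beta' - 1) / n.+2%:R by rewrite divr_ge0// ltW.
  apply: (@le_trans _ _ (L n * (1 + (beta' - 1) / n.+2%:R) `^ alpha)); last first.
    rewrite ler_pM2l ?hazard_gt0// /g -mulrA; apply: powR1D_le => //; exact: ltW.
  have bm0 : 0 <= beta * m n by rewrite mulr_ge0// ltW// mean_gt0.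
  rewrite /L -powRM ?addr_ge0//.
  apply: ge0_ler_powR; rewrite ?nnegrE ?(ltW alpha0)//.
  - by rewrite mulr_ge0// ltW// mean_gt0.
  - by rewrite mulr_ge0// addr_ge0.
  rewrite -mulrA ler_pM2l// mS ler_pdivrMr// -[leRHS]mulrA.
  have -> : (1 + (beta' - 1) / n.+2%:R) * n.+2%:R = n.+1%:R + beta'.
    by rewrite mulrDl mul1r divfK// -[n.+2%:R]natr1; ring.
  by rewrite mulrDr lerD2l mulrC yle.
have [C C0 LC] : exists2 C, 0 < C & forall n, L n <= C * n.+1%:R `^ g.
  apply: (@ge_term_bound _ L (fun n => n.+1%:R `^ g) n0 (L n0 / n0.+1%:R `^ g)).
    by move=> n; rewrite powR_gt0.
  move=> n n0n; rewrite -(subnKC n0n); elim: (n - n0)%N => [|k IH].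
    by rewrite addn0 divfK// gt_eqF// powR_gt0.
  rewrite addnS (le_trans (step _ (leq_addr _ _)))//.
  move: (n0 + k)%N IH => {k n n0n} k IH.
  have k0 : (0 : R) < k.+1%:R by [].
  have -> : k.+2%:R = k.+1%:R * (1 + k.+1%:R^-1) :> R.
    by rewrite mulrDr mulr1 divff ?gt_eqF// natr1.
  rewrite powRM ?addr_ge0 ?invr_ge0// mulrA ler_pM ?expR_ge0 ?(ltW (hazard_gt0 _))//.
  rewrite /powR gt_eqF ?ltr_pwDl ?invr_ge0// ler_expR ler_pM2l//.
  apply: (@le_trans _ _ (k.+1%:R^-1 / (1 + k.+1%:R^-1))); last first.
    by rewrite ln1D_ge// invr_ge0.
  rewrite le_eqVlt; apply/orP; left; apply/eqP.
  move: (k.+1%:R) k0 => t t0; field.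
  by do ?[apply/andP; split]; apply: lt0r_neq0; lra.
apply: (@ge_term_bound _ (fun n => L n.+1 - L n) (fun n => n.+1%:R `^ (g - 1))
  n0 (C * (expR 1 * g))); first by move=> n; rewrite powR_gt0.
move=> n n0n; have t0 : (0 : R) < n.+1%:R by [].
have t1 : (1 : R) <= n.+1%:R by rewrite ler1n.
apply: (@le_trans _ _ (L n * (expR (g / n.+2%:R) - 1))).
  by rewrite mulrBr mulr1 lerD2r step.
(* As g <= 1 the exponent u is at most 1, so e^u - 1 <= u e^u <= e u. *)
have e1 : expR (g / n.+2%:R) - 1 <= expR 1 * g / n.+1%:R.
  have x1 : g / n.+2%:R <= 1 by rewrite ler_pdivrMr// mul1r (le_trans g1)// ler1n.
  have x0 : 0 <= g / n.+2%:R by rewrite divr_ge0// ltW.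
  apply: (@le_trans _ _ (expR 1 * (g / n.+2%:R))).
    apply: (@le_trans _ _ (expR (g / n.+2%:R) * (g / n.+2%:R))).
      rewrite lerBlDl -lerBlDr -[X in X - _]mulr1 -mulrBr.
      rewrite mulrC -ler_pdivlMr ?expR_gt0// mul1r -expRN.
      exact: expR_ge1Dx.
    by rewrite ler_wpM2r// ler_expR.
  rewrite -!mulrA !ler_pM2l ?expR_gt0// lef_pV2 ?posrE// ler_nat.
  exact: leqnSn.
have e0 : 0 <= expR (g / n.+2%:R) - 1.
  by rewrite subr_ge0 -expR0 ler_expR divr_ge0// ltW.
apply: (le_trans (ler_pM (ltW (hazard_gt0 n)) e0 (LC n) e1)).
rewrite powR_natrB1.
by rewrite le_eqVlt; apply/orP; left; apply/eqP; ring.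
Qed.

End growth.

(** * Recursions for the shares and for the second moment *)

Section rates.
Context {R : realType}.
Implicit Types (c p s : R) (n : nat).

Lemma powRN_natr_cvg0 s : 0 < s -> n.+1%:R `^ (- s) @[n --> \oo] --> (0 : R).
Proof.
move=> s0; apply/cvgrPdist_le => /= e e0.
have [n0 h] := powR_natr_ge e^-1 s0.
near=> n; rewrite sub0r normrN ger0_norm ?powR_ge0// powRN -[e]invrK.
rewrite lef_pV2 ?posrE ?invr_gt0 ?powR_gt0// h//.
by near: n; exact: nbhs_infty_ge.
Unshelve. all: by end_near. Qed.

Lemma expRN_powR_le c s p : 0 < c -> 0 < s -> 0 < p ->
  exists K : R, forall n, expR (- (c * n.+1%:R `^ s)) <= K * n.+1%:R `^ (- p).
Proof.
move=> c0 s0 p0; have ps0 : 0 < p / s by rewrite divr_gt0.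
exists ((p / s) `^ (p / s) * c `^ (- (p / s))) => n.
have t0 : 0 < n.+1%:R `^ s :> R by rewrite powR_gt0.
apply: (le_trans (expRN_le_powR ps0 (mulr_gt0 c0 t0))).
rewrite [(c * _) `^ _]powRM ?(ltW c0) ?(ltW t0)// mulrA -powRrM.
by rewrite (_ : s * - (p / s) = - p)//; field; rewrite gt_eqF.
Qed.

Lemma expRN_increment_cvg0 (u : nat -> R) c s (p : nat) : 0 < c -> 0 < s ->
  (forall n, c * n.+1%:R `^ s <= u n) ->
  n.+2%:R ^+ p * expR (- u n) @[n --> \oo] --> (0 : R).
Proof.
move=> c0 s0 cu; have p0 : (0 : R) < p.+1%:R by [].
have [K hK] := expRN_powR_le c0 s0 p0.
have K0 : 0 <= K.
  have := hK 0%N; rewrite !powR1/= !mulr1; exact: le_trans (expR_ge0 _).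
apply: (@squeeze_cvgr _ _ _ _ (fun=> 0) (fun n => (2 ^+ p * K) * n.+1%:R `^ (- 1))).
- near=> n; rewrite mulr_ge0 ?exprn_ge0 ?expR_ge0//=.
  apply: (@le_trans _ _ ((2 * n.+1%:R) ^+ p * (K * n.+1%:R `^ (- p.+1%:R)))).
    apply: ler_pM; rewrite ?exprn_ge0 ?expR_ge0//.
      by rewrite lerXn2r ?nnegrE ?mulr_ge0// -natrM ler_nat; lia.
    by apply: le_trans (hK n); rewrite ler_expR lerN2.
  rewrite exprMn -(natr1 p) opprD powRD; last by apply/implyP => _; rewrite gt_eqF.
  have : n.+1%:R ^+ p != 0 :> R by rewrite expf_neq0.
  rewrite powR_invn//; move: (n.+1%:R `^ (- 1)) (n.+1%:R ^+ p) (2 ^+ p) => w z b z0.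
  by rewrite le_eqVlt; apply/orP; left; apply/eqP; field.
- exact: cvg_cst.
- rewrite -[X in _ --> X](mulr0 (2 ^+ p * K)).
  by apply: cvgMr; exact: powRN_natr_cvg0.
Unshelve. all: by end_near. Qed.

Section hazard_ratio.
Variable L : nat -> R.
Let a n := expR (L n).
Let S n := \sum_(0 <= j < n) a j.

Lemma expR_sum_gt0 n : 0 < S n.+1.
Proof.
rewrite /S big_nat_recr//= ltr_wpDl ?expR_gt0// sumr_ge0// => j _; exact: expR_ge0.
Qed.

(** The inverse share obeys an affine recursion whose factor is the ratio of consecutive hazards;
    this turns bounds on increments of [L] into bounds on shares. *)
Lemma hazard_ratioS n :
  S n.+2 / a n.+1 = 1 + S n.+1 / a n * expR (- (L n.+1 - L n)).
Proof.
rewrite /S big_nat_recr//= -/(S n.+1) mulrDl addrC divff ?gt_eqF ?expR_gt0//.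
by congr (_ + _); rewrite opprB expRD expRN -mulrA [_^-1 * _]mulrA mulVf ?mul1r// gt_eqF ?expR_gt0.
Qed.

Lemma hazard_ratio_upper c delta : 0 < c -> 0 <= delta <= 1 ->
  (forall n, c * n.+1%:R `^ (- delta) <= L n.+1 - L n) ->
  exists2 C, 0 < C & forall n, S n.+1 / a n <= C * n.+1%:R `^ delta.
Proof.
(* Capping c at 1 keeps x = c1 (n+1)^-delta within [0, 1], where e^-x <= 1 - x/2. The constant C =
   2/c1 solves 1 + C w (1 - c1/(2w)) = C w with w = (n+1)^delta. *)
move=> c0 /andP[d0 d1] cL; pose c1 := Num.min c 1.
have c10 : 0 < c1 by rewrite lt_min c0 ltr01.
have c11 : c1 <= 1 by rewrite ge_min lexx orbT.
exists (2 / c1); first by rewrite divr_gt0.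
elim=> [|n IH].
  rewrite /S big_nat1 divff ?gt_eqF ?expR_gt0// powR1 mulr1 ler_pdivlMr//; lra.
rewrite hazard_ratioS.
have w1 : 1 <= n.+1%:R `^ delta :> R.
  by rewrite -[leLHS](powRr0 n.+1%:R) ler_powR ?ler1n.
have w0 : 0 < n.+1%:R `^ delta :> R by rewrite (lt_le_trans _ w1).
have w2 : n.+1%:R `^ delta <= n.+2%:R `^ delta :> R.
  by rewrite ge0_ler_powR ?nnegrE// ler_nat.
have e1 : expR (- (L n.+1 - L n)) <= 1 - c1 / n.+1%:R `^ delta / 2.
  have x0 : 0 < c1 / n.+1%:R `^ delta by rewrite divr_gt0.
  have x1 : c1 / n.+1%:R `^ delta <= 1.
    by rewrite ler_pdivrMr// mul1r (le_trans c11).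
  have : expR (- (L n.+1 - L n)) <= expR (- (c1 / n.+1%:R `^ delta)).
    rewrite ler_expR lerN2 (le_trans _ (cL n))// powRN ler_wpM2r ?invr_ge0 ?powR_ge0//.
    by rewrite ge_min lexx.
  move/le_trans; apply; move: (c1 / _) x0 x1 => x x0 x1.
  rewrite expRN; apply: (@le_trans _ _ (1 + x)^-1).
    by rewrite lef_pV2 ?posrE ?expR_gt0 ?expR_ge1Dx// ltr_pwDl// ltW.
  by rewrite -[leLHS]mul1r ler_pdivrMr; nra.
apply: (@le_trans _ _ (1 + 2 / c1 * n.+1%:R `^ delta * (1 - c1 / n.+1%:R `^ delta / 2))).
  by rewrite lerD2l ler_pM ?expR_ge0// divr_ge0 ?expR_ge0// ltW// expR_sum_gt0.
have -> : 1 + 2 / c1 * n.+1%:R `^ delta * (1 - c1 / n.+1%:R `^ delta / 2) =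
    2 / c1 * n.+1%:R `^ delta.
  by field; rewrite !gt_eqF.
by rewrite ler_pM2l// divr_gt0.
Qed.

Lemma hazard_ratio_lower C delta : 0 < C -> 0 < delta <= 1 ->
  (forall n, L n.+1 - L n <= C * n.+1%:R `^ (- delta)) ->
  exists2 c, 0 < c & forall n, c * n.+1%:R `^ delta <= S n.+1 / a n.
Proof.
move=> C0 /andP[d0 d1] LC; have C10 : 0 < 1 + C by rewrite addr_gt0.
(* With e^-u >= 1 - u this constant turns the recursion into (w + 1)/(1 + C), where w = (n+1)^delta;
   this dominates (n+2)^delta/(1 + C) by [powR_succ_le_add1]. *)
exists (1 + C)^-1; first by rewrite invr_gt0.
elim=> [|n IH].
  rewrite /S big_nat1 divff ?gt_eqF ?expR_gt0// powR1 mulr1 invf_le1//.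
  by rewrite lerDl ltW.
rewrite hazard_ratioS.
have w0 : 0 < n.+1%:R `^ delta :> R by rewrite powR_gt0.
apply: (@le_trans _ _ (1 + (1 + C)^-1 * n.+1%:R `^ delta * expR (- (L n.+1 - L n)))).
  apply: (@le_trans _ _ (1 + (1 + C)^-1 * n.+1%:R `^ delta * (1 - C / n.+1%:R `^ delta))).
    have -> : 1 + (1 + C)^-1 * n.+1%:R `^ delta * (1 - C / n.+1%:R `^ delta) =
        (1 + C)^-1 * (n.+1%:R `^ delta + 1).
      by field; rewrite !gt_eqF.
    by rewrite ler_pM2l ?invr_gt0// powR_succ_le_add1// (ltW d0).
  rewrite lerD2l ler_pM2l ?mulr_gt0 ?invr_gt0//.
  apply: le_trans (expR_ge1Dx _); rewrite lerD2l lerN2.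
  by rewrite (le_trans (LC n))// powRN.
by rewrite lerD2l ler_wpM2r ?expR_ge0.
Qed.

End hazard_ratio.

(** The rate is the equilibrium of the recursion: the noise n^(-2 delta') divided by the contraction
    n^-delta. The bound delta < 1 makes the relative change of this rate in one step, of order 1/n,
    negligible against the contraction. *)
Lemma contraction_rate (v : nat -> R) (N delta delta' : R) :
  1 <= N -> delta' <= delta -> delta < 1 -> delta < 2 * delta' ->
  (forall n, 0 <= v n) ->
  (forall n, (0 < n)%N -> v n.+1 <=
     (1 - n.+1%:R `^ (- delta) / N) * v n + (N * n.+1%:R `^ (- delta')) ^+ 2) ->
  exists2 M, 0 < M & forall n, v n.+1 <= M * n.+1%:R `^ (- (2 * delta' - delta)).
Proof.
move=> N1 d'd d1 dd' v0 vS.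
have N0 : 0 < N by rewrite (lt_le_trans _ N1).
have d1' : 0 < 1 - delta by rewrite subr_gt0.
pose k := 2 * delta' - delta; have k0 : 0 < k by rewrite subr_gt0.
have k1 : k <= 1 by rewrite /k; lra.
have [n0 hn0] := powR_natr_ge (4 * N) d1'.
(* Half of the contraction e/N absorbs the change of the weight, which is why h <= e/(2N) is
   arranged from n0 on. The other half pays for the noise: N^2 e <= M e/(2N) as soon as M >= 2
   N^3. *)
pose M := Num.max (2 * N ^+ 3) (v n0.+1 / n0.+1%:R `^ (- k)).
apply: (@ge_term_bound _ (fun n => v n.+1) (fun n => n.+1%:R `^ (- k)) n0 M).
  by move=> n; rewrite powR_gt0.
move=> n n0n; rewrite -(subnKC n0n); elim: (n - n0)%N => [|j IH].
  by rewrite addn0 -ler_pdivrMr ?powR_gt0// /M le_max lexx orbT.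
rewrite addnS; move: (n0 + j)%N (leq_addr j n0) IH => {n n0n j} n n0n IH.
apply: (le_trans (vS n.+1 _)) => //.
have t0 : (0 : R) < n.+2%:R by [].
have n1 : (0 : R) < n.+1%:R by [].
pose e : R := n.+2%:R `^ (- delta).
pose h : R := n.+1%:R^-1.
have e0 : 0 < e by rewrite powR_gt0.
have h0 : 0 < h by rewrite invr_gt0.
have eN : e <= 1.
  have [d0|d0] := leP 0 delta.
    by rewrite /e powRN invf_le1 ?powR_gt0// -[leLHS](powRr0 n.+2%:R) ler_powR ?ler1n.
  by exfalso; lra.
have he : h <= e / (2 * N).
  apply: (@le_trans _ _ (2 / n.+2%:R)).
    rewrite ler_pdivlMr// /h ler_pdivrMl// -natrM ler_nat.
    by clear; lia.
  rewrite ler_pdivlMr ?mulr_gt0// mulrAC ler_pdivrMr//.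
  have -> : e * n.+2%:R = n.+2%:R `^ (1 - delta).
    rewrite /e addrC powRD ?powRr1//; apply/implyP => _; by rewrite gt_eqF.
  by apply: le_trans (hn0 n.+1 (leqW n0n)); lra.
have wE : n.+1%:R `^ (- k) <= n.+2%:R `^ (- k) * (1 + h).
  have -> : n.+2%:R = n.+1%:R * (1 + h) :> R.
    by rewrite /h mulrDr mulr1 divff ?gt_eqF// natr1.
  rewrite powRM ?addr_ge0 ?(ltW h0)// -mulrA ler_peMr ?powR_ge0//.
  rewrite powRN ler_pdivlMl ?powR_gt0 ?addr_gt0// mulr1.
  by rewrite ler1_powR// lerDl ltW.
have sqE : (N * n.+2%:R `^ (- delta')) ^+ 2 = N ^+ 2 * (n.+2%:R `^ (- k) * e).
  rewrite exprMn -[_ `^ _ ^+ 2]powR_mulrn ?powR_ge0// -powRrM /e -powRD; last first.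
    by apply/implyP => _; rewrite gt_eqF.
  by congr (_ * _ `^ _); rewrite /k; ring.
rewrite sqE -/e.
have eN1 : 0 <= 1 - e / N.
  by rewrite subr_ge0 ler_pdivrMr// mul1r (le_trans eN).
have M0 : 2 * N ^+ 3 <= M by rewrite le_max lexx.
move: (n.+2%:R `^ (- k)) (powR_gt0 (- k) t0) wE => w w0 wE.
have M00 : 0 <= M by apply: le_trans M0; rewrite mulr_ge0// exprn_ge0// ltW.
have h1 : (1 - e / N) * v n.+1 <= (1 - e / N) * (M * (w * (1 + h))).
  by rewrite ler_wpM2l// (le_trans IH)// ler_wpM2l.
apply: (le_trans (lerD h1 (lexx _))).
suff : (1 - e / N) * (M * (1 + h)) + N ^+ 2 * e <= M.
  move/(ler_wpM2r (ltW w0)); apply: le_trans; rewrite le_eqVlt; apply/orP; left.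
  by apply/eqP; ring.
have h2 : h * N <= e / 2.
  by move: he; rewrite ler_pdivlMr ?mulr_gt0//; lra.
have h3 : (1 - e / N) * (1 + h) <= 1 - e / N / 2.
  have -> : e / N / 2 = e / (2 * N) by field; rewrite gt_eqF.
  have e2 : e / N = 2 * (e / (2 * N)) by field; rewrite gt_eqF.
  have : 0 <= e / N * h by rewrite mulr_ge0 ?divr_ge0 ?(ltW e0) ?(ltW N0) ?(ltW h0).
  move: he; rewrite e2; nra.
rewrite [leLHS](_ : _ = M * ((1 - e / N) * (1 + h)) + N ^+ 2 * e); last by ring.
apply: (le_trans (lerD (ler_wpM2l M00 h3) (lexx _))).
have : N ^+ 2 * e <= M * (e / N / 2).
  apply: (@le_trans _ _ (2 * N ^+ 3 * (e / N / 2))).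
    by rewrite le_eqVlt; apply/orP; left; apply/eqP; field; rewrite gt_eqF.
  by rewrite ler_wpM2r// !divr_ge0// ltW.
lra.
Qed.

Lemma ex_square n : exists k, (k ^ 2 <= n < k.+1 ^ 2)%N.
Proof.
elim: n => [|n [k /andP[h1 h2]]]; first by exists 0%N.
have [h3|h3] := ltnP n.+1 (k.+1 ^ 2).
  by exists k; rewrite h3 (leq_trans h1).
exists k.+1; rewrite h3/=; apply: leq_ltn_trans h2 _.
by rewrite ltn_sqr.
Qed.

(* By monotonicity, between consecutive squares u n / S n lies between
   u (k^2) / S ((k+1)^2) and u ((k+1)^2) / S (k^2). *)
Lemma cvg_ratio_squares (u S : nat -> R) :
  (forall n, 0 <= u n) -> (forall n, 0 < S n.+1) ->
  {homo u : m n / (m <= n)%N >-> m <= n} -> {homo S : m n / (m <= n)%N >-> m <= n} ->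
  u (n ^ 2)%N / S (n ^ 2)%N @[n --> \oo] --> (1 : R) ->
  S (n ^ 2)%N / S (n.+1 ^ 2)%N @[n --> \oo] --> (1 : R) ->
  u n / S n @[n --> \oo] --> (1 : R).
Proof.
move=> u0 S0 uh Sh uS SS.
have S0' n : (0 < n)%N -> 0 < S n by case: n.
pose low k := u (k ^ 2)%N / S (k ^ 2)%N * (S (k ^ 2)%N / S (k.+1 ^ 2)%N).
pose up k := u (k.+1 ^ 2)%N / S (k.+1 ^ 2)%N / (S (k ^ 2)%N / S (k.+1 ^ 2)%N).
have lowP : low k @[k --> \oo] --> (1 : R).
  by rewrite -[X in _ --> X](mulr1 1); exact: cvgM.
have upP : up k @[k --> \oo] --> (1 : R).
  rewrite -[X in _ --> X](mulr1 1) -[X in _ * X]invr1; apply: cvgM.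
    by rewrite (cvg_shiftS (fun k => u (k ^ 2)%N / S (k ^ 2)%N)).
  by apply: cvgV => //; exact: oner_neq0.
apply/cvgrPdist_le => /= e e0.
move/cvgrPdist_le : lowP => /(_ e e0)[K1 _ hl].
move/cvgrPdist_le : upP => /(_ e e0)[K2 _ hu].
exists ((maxn 1 (maxn K1 K2)) ^ 2)%N => // n /= Kn.
have [k /andP[kn nk]] := ex_square n.
have Kk : (maxn 1 (maxn K1 K2) <= k)%N.
  by rewrite -ltnS -ltn_sqr (leq_ltn_trans Kn).
move: Kk; rewrite !geq_max => /and3P[k1 K1k K2k].
have sk : 0 < S (k ^ 2)%N by rewrite S0'// expn_gt0 k1.
have sk1 : 0 < S (k.+1 ^ 2)%N by rewrite S0'// expn_gt0.
have sn : 0 < S n by rewrite S0'// (leq_trans _ kn)// expn_gt0 k1.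
have := hl k K1k; have := hu k K2k; rewrite !ler_distlC.
have -> : low k = u (k ^ 2)%N / S (k.+1 ^ 2)%N.
  by rewrite /low mulrA divfK// gt_eqF.
have -> : up k = u (k.+1 ^ 2)%N / S (k ^ 2)%N.
  by rewrite /up invf_div mulrA divfK// gt_eqF.
move=> /andP[_ h2] /andP[h1 _]; apply/andP; split.
  apply: (le_trans h1); apply: ler_pM => //; first by rewrite invr_ge0 ltW.
    exact: uh.
  by rewrite lef_pV2// Sh// ltnW.
apply: le_trans h2; apply: ler_pM => //; first by rewrite invr_ge0 ltW.
  by rewrite uh// ltnW.
by rewrite lef_pV2// Sh.
Qed.

(** Going back one index multiplies S by one minus a share. There are 2n + 1 indices between
    consecutive squares, with shares of order n^(-2 delta), so the total loss is of order n^(1 - 2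
    delta). *)
Lemma partial_sum_ratio_squares (a : nat -> R) (N delta : R) :
  let S n := \sum_(0 <= j < n) a j in
  (forall n, 0 < a n) -> 2^-1 < delta -> 0 <= N ->
  (forall n, a n / S n.+1 <= N * n.+1%:R `^ (- delta)) ->
  S (n ^ 2)%N / S (n.+1 ^ 2)%N @[n --> \oo] --> (1 : R).
Proof.
move=> S a0 d2 N0 aS.
have d0 : 0 < delta by rewrite (lt_trans _ d2)// invr_gt0.
have S0 n : 0 < S n.+1.
  by rewrite /S big_nat_recr//= ltr_wpDl// sumr_ge0// => j _; exact: ltW.
have Sge0 n : 0 <= S n by rewrite /S sumr_ge0// => j _; exact: ltW.
have Sincr n : S n.+1 = S n + a n by rewrite /S big_nat_recr.
have step m (p : nat) : (0 < m)%N ->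
    1 - p%:R * (N * m.+1%:R `^ (- delta)) <= S m / S (m + p)%N.
  move=> m0; elim: p => [|p IH].
    by rewrite addn0 mul0r subr0 divff// gt_eqF//; case: m m0.
  have Sp0 : 0 < S (m + p)%N by case: m m0 {IH} => // m _; rewrite addSn.
  have r0 : 0 <= a (m + p)%N / S (m + p).+1 by rewrite divr_ge0// ltW.
  have rle : a (m + p)%N / S (m + p).+1 <= N * m.+1%:R `^ (- delta).
    apply: (le_trans (aS _)); rewrite ler_wpM2l// !powRN lef_pV2 ?posrE ?powR_gt0//.
    by rewrite ge0_ler_powR ?nnegrE ?(ltW d0)// ler_nat ltnS leq_addr.
  have -> : S m / S (m + p.+1)%N =
      S m / S (m + p)%N * (1 - a (m + p)%N / S (m + p).+1).
    rewrite addnS !Sincr; move: (S (m + p)%N) (a (m + p)%N) (a0 (m + p)%N) Sp0.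
    move=> s b b0 s0; field; rewrite !gt_eqF// ?addr_gt0//.
  have le1 : S m / S (m + p)%N <= 1.
    rewrite ler_pdivrMr// mul1r; elim: p {IH Sp0 r0 rle} => [|p IH]; first by rewrite addn0.
    by rewrite addnS Sincr (le_trans IH)// lerDl ltW.
  rewrite -natr1 mulrDl mul1r mulrBr mulr1.
  have : S m / S (m + p)%N * (a (m + p)%N / S (m + p).+1) <= N * m.+1%:R `^ (- delta).
    by apply: le_trans rle; rewrite ler_piMl.
  lra.
have s0 : 0 < 2 * delta - 1 by move: d2; rewrite -(ltr_pM2l (ltr0Sn _ 1)) mulfV//; lra.
have sqle (k : nat) :
    (k ^ 2).+1%:R `^ (- delta) <= 2 `^ delta * k.+1%:R `^ (- (2 * delta)) :> R.
  have -> : k.+1%:R `^ (- (2 * delta)) = (k.+1%:R ^+ 2) `^ (- delta) :> R.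
    by rewrite -powR_mulrn// -powRrM mulrN.
  have w0 : 0 < (k ^ 2).+1%:R `^ delta :> R by rewrite powR_gt0.
  rewrite !powRN ler_pdivlMr ?powR_gt0 ?exprn_gt0// ler_pdivrMl//.
  rewrite -powRM// ge0_ler_powR ?nnegrE ?mulr_ge0 ?exprn_ge0 ?(ltW d0)//.
  by rewrite -natrX -natrM ler_nat; nia.
apply: (@squeeze_cvgr _ _ _ _
    (fun k => 1 - N * 2 * 2 `^ delta * k.+1%:R `^ (- (2 * delta - 1))) (fun=> 1)).
- near=> k; apply/andP; split; last first.
    rewrite ler_pdivrMr ?mul1r//; last by case: (k.+1 ^ 2)%N (expn_gt0 k.+1 2).
    have : (k ^ 2 <= k.+1 ^ 2)%N by rewrite leq_sqr.
    move=> /subnKC <-; elim: (_ - _)%N => [|p IH]; first by rewrite addn0.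
    by rewrite addnS Sincr (le_trans IH)// lerDl ltW.
  have k0 : (0 < k)%N by near: k; exact: nbhs_infty_gt.
  have -> : (k.+1 ^ 2 = k ^ 2 + (2 * k).+1)%N by lia.
  apply: le_trans (step _ (2 * k).+1 _); last by rewrite expn_gt0 k0.
  rewrite lerD2l lerN2.
  apply: (@le_trans _ _ ((2 * k.+1%:R) * (N * (2 `^ delta * k.+1%:R `^ (- (2 * delta)))))).
    apply: ler_pM; rewrite ?mulr_ge0 ?powR_ge0//.
      by rewrite -natrM ler_nat; lia.
    by rewrite ler_wpM2l.
  have -> : k.+1%:R `^ (- (2 * delta - 1)) = k.+1%:R * k.+1%:R `^ (- (2 * delta)) :> R.
    rewrite opprB powRD ?powRr1//; apply/implyP => _; by rewrite gt_eqF.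
  by rewrite le_eqVlt; apply/orP; left; apply/eqP; ring.
- rewrite -[X in _ --> X]subr0; apply: cvgB; first exact: cvg_cst.
  rewrite -(mulr0 (N * 2 * 2 `^ delta)).
  by apply: cvgMr; exact: powRN_natr_cvg0.
- exact: cvg_cst.
Unshelve. all: by end_near. Qed.

End rates.

(** * Good paths *)

Section measurability_and_convergence.
Context d (T : measurableType d) (R : realType).

Lemma measurable_inv_ge0 (f : T -> R) : (forall w, 0 <= f w) ->
  measurable_fun setT f -> measurable_fun setT (fun w => (f w)^-1).
Proof.
move=> f0 mf; rewrite (_ : (fun w => _) = (fun w => f w `^ (-1))).
  exact: (measurableT_comp (measurable_powR _) mf).
by apply/funext => w; rewrite powR_inv1.
Qed.

Lemma measurable_truncn (f : T -> R) : measurable_fun setT f ->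
  measurable_fun setT (fun w => Num.truncn (f w)).
Proof.
move=> mf; apply: measurable_natP => n.
rewrite (_ : (fun w => _) = (fun w => (n.+1%:R <= f w) && (f w < n.+2%:R))).
  apply: measurable_and.
    exact: measurable_fun_ler.
  exact: measurable_fun_ltr.
by apply/funext => w; rewrite -truncn_gt_nat -truncn_le_nat eqn_leq andbC.
Qed.

Lemma measurable_random_exp (q : T -> R) (k : T -> nat) :
  measurable_fun setT q -> measurable_fun setT k ->
  measurable_fun setT (fun w => q w ^+ k w).
Proof.
move=> mq mk; apply: (@measurable_at_index _ _ _ (fun k w => q w ^+ k)) => // n.
exact: measurable_funX.
Qed.

(** Borel-Cantelli in integrated form: the sum of the [f n] has a finite integral, hence is finite
    almost everywhere, and its terms tend to 0. *)
Lemma ae_cvg0_of_summable (P : {measure set T -> \bar R}) (f : nat -> T -> R) (C : R) :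
  (forall n, measurable_fun setT (f n)) -> (forall n w, 0 <= f n w) ->
  (forall N, \sum_(0 <= n < N) \int[P]_w (f n w)%:E <= C%:E)%E ->
  {ae P, forall w, f n w @[n --> \oo] --> (0 : R)}.
Proof.
move=> mf f0 fC.
have mfE n : measurable_fun setT (fun w => (f n w)%:E) by exact/measurable_EFinP.
pose g w := (\sum_(n <oo) (f n w)%:E)%E.
have g0 w : (0 <= g w)%E by apply: nneseries_ge0 => n _ _; rewrite lee_fin.
have mg : measurable_fun setT g.
  by apply: ge0_emeasurable_sum => // n w _ _; rewrite lee_fin.
have ig : P.-integrable setT g.
  apply/integrableP; split => //.
  under eq_integral do rewrite gee0_abs//.
  rewrite integral_nneseries//; last by move=> n w _; rewrite lee_fin.
  apply: (@le_lt_trans _ _ C%:E); last exact: ltry.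
  by apply: nneseries_le_bound => // n; apply: integral_ge0 => w _; rewrite lee_fin.
apply: filterS (integrable_ae measurableT ig) => w /(_ I) gfin.
apply: cvg_series_cvg_0; apply: nondecreasing_is_cvgn.
  by apply/nondecreasing_seqP => n; rewrite /series/= big_nat_recr//= lerDl.
exists (fine (g w)) => _ [n _ <-]; rewrite -lee_fin fineK// -sumEFin.
by apply: nneseries_lim_ge => *; rewrite lee_fin.
Qed.

End measurability_and_convergence.

(** * Geometric tails and their exponential limit *)

Lemma geometric_tail_le (R : realType) (q : R) k N : 0 <= q <= 1 ->
  \sum_(0 <= g < N) (k < g.+1)%N%:R * q ^+ g * (1 - q) <= q ^+ k.
Proof.
move=> /andP[q0 q1].
suff -> : \sum_(0 <= g < N) (k < g.+1)%N%:R * q ^+ g * (1 - q) = q ^+ k - q ^+ maxn k N.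
  by rewrite lerBlDr lerDl exprn_ge0.
elim: N => [|N IH]; first by rewrite big_geq// maxn0 subrr.
rewrite big_nat_recr//= IH ltnS; case: leqP => kN.
  by rewrite mul1r (maxn_idPr (leqW kN)) exprSr; ring.
by rewrite !mul0r addr0 (maxn_idPl kN).
Qed.

Lemma geometric_head_le (R : realType) (q : R) k N : 0 <= q <= 1 ->
  \sum_(0 <= g < N) (g < k)%N%:R * q ^+ g * (1 - q) <= 1 - q ^+ k.
Proof.
move=> /andP[q0 q1].
suff -> : \sum_(0 <= g < N) (g < k)%N%:R * q ^+ g * (1 - q) = 1 - q ^+ minn k N.
  by rewrite lerD2l lerN2 ler_wiXn2l// geq_minl.
elim: N => [|N IH]; first by rewrite big_geq// minn0 expr0 subrr.
rewrite big_nat_recr//= IH; case: (ltnP N k) => kN.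
  by rewrite mul1r (minn_idPr kN) exprSr; ring.
by rewrite !mul0r addr0 (minn_idPl (leqW kN)).
Qed.

(** The inequality 1 + u <= e^u, applied to u = -p and to u = p/(1-p), squeezes (1-p)^k between
    exp(-kp/(1-p)) and exp(-kp). *)
Lemma cvg_geometric_to_exp (R : realType) (p : nat -> R) (k : nat -> nat) (b : R) :
  (forall n, 0 < p n <= 1) -> p n @[n --> \oo] --> 0 ->
  (k n)%:R * p n @[n --> \oo] --> b ->
  (1 - p n) ^+ k n @[n --> \oo] --> expR (- b).
Proof.
move=> p01 p0 kp.
have cexp (u : nat -> R) l : u n @[n --> \oo] --> l ->
    expR (- u n) @[n --> \oo] --> expR (- l).
  move=> ul; apply: (cvg_comp _ _ (cvgN ul)); exact: continuous_expR.
apply: (@squeeze_cvgr _ _ _ _ (fun n => expR (- ((k n)%:R * p n / (1 - p n))))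
   (fun n => expR (- ((k n)%:R * p n)))).
- near=> n; have /andP[pn0 pn1] := p01 n.
  have pn : p n < 1 by near: n; apply: cvgr_lt p0 _ ltr01.
  have q0 : 0 < 1 - p n by rewrite subr_gt0.
  apply/andP; split.
    rewrite -mulrA -mulrN mulrC expRM_natr lerXn2r ?nnegrE ?expR_ge0 ?(ltW q0)//.
    rewrite expRN -[leRHS]invrK lef_pV2 ?posrE ?expR_gt0 ?invr_gt0//.
    apply: le_trans (expR_ge1Dx _).
    by rewrite le_eqVlt; apply/orP; left; apply/eqP; field; rewrite gt_eqF.
  rewrite -mulrN mulrC expRM_natr lerXn2r ?nnegrE ?expR_ge0 ?(ltW q0)//.
  exact: expR_ge1Dx.
- apply: cexp; rewrite -[X in _ --> X](mulr1 b) -[X in _ * X]invr1.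
  apply: cvgM => //; apply: cvgV; first exact: oner_neq0.
  by rewrite -[X in _ --> X]subr0; apply: cvgB => //; exact: cvg_cst.
- exact: cexp.
Unshelve. all: by end_near. Qed.

(** Truncation costs at most [p n]. Negative numbers are truncated to 0, whence the maximum in the
    limit. *)
Lemma cvg_truncn_scaled (R : realType) (z p : nat -> R) (a : R) :
  (forall n, 0 < p n) -> p n @[n --> \oo] --> 0 ->
  z n * p n @[n --> \oo] --> a ->
  (Num.truncn (z n))%:R * p n @[n --> \oo] --> Num.max a 0.
Proof.
move=> p0 p_0 zp.
have mx : Num.max (z n * p n) 0 @[n --> \oo] --> Num.max a 0.
  have maxE (u : R) : Num.max u 0 = (u + `|u|) / 2.
    by rewrite maxr_absE addr0 subr0.
  under eq_fun do rewrite maxE; rewrite maxE.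
  by apply: cvgM; [apply: cvgD => //; exact: cvg_norm|exact: cvg_cst].
apply: (@squeeze_cvgr _ _ _ _ (fun n => Num.max (z n * p n) 0 - p n)
   (fun n => Num.max (z n * p n) 0)) => //.
- near=> n.
  have [zn|zn] := leP 0 (z n).
    rewrite max_l ?mulr_ge0 ?(ltW (p0 n))//.
    rewrite ler_pM2r// truncn_le zn andbT -{2}[p n]mul1r -mulrBl ler_pM2r//.
    by rewrite lerBlDr natr1 ltW// truncnS_gt.
  rewrite max_r; last by rewrite nmulr_rle0 ?(ltW (p0 n)).
  rewrite (_ : Num.truncn (z n) = 0%N) ?mul0r ?lexx ?andbT ?sub0r ?oppr_le0 ?(ltW (p0 n))//.
  by apply/eqP; rewrite -leqn0 truncn_le_nat (lt_trans zn).
- rewrite -[X in _ --> X]subr0; exact: cvgB.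
Unshelve. all: by end_near. Qed.

(** * The selection rule along a good path *)

Section good_paths.
Context {R : realType}.
Variables (alpha beta : R).
Hypotheses (alpha_gt0 : 0 < alpha) (beta_gt1 : 1 < beta).
Implicit Types (x : nat -> R) (n : nat).

Local Notation F := (weibull_cdf alpha).
Local Notation stime := (stime beta).
Local Notation smean := (smean beta).
Local Notation svalue := (svalue beta).
Local Notation thr := (threshold beta).
Local Notation increasing := (increasing_stimes beta).

Definition hazard x n : R := (1 - F (thr x n))^-1.
Definition hazard_sum x n : R := \sum_(0 <= j < n) hazard x j.

Definition good_path x := [/\ forall i, 0 <= x i, 0 < x 0%N &
  forall n M : nat, exists2 i, (n <= i)%N & M%:R < x i].

Lemma weibull_cdf_lt1 c : F c < 1.
Proof.
rewrite /weibull_cdf; case: ifP => _; last exact: ltr01.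
by rewrite ltrBlDr ltrDl expR_gt0.
Qed.

Lemma weibull_cdf_ge0 c : 0 <= F c.
Proof.
rewrite /weibull_cdf; case: ifP => // c0.
by rewrite subr_ge0 -expR0 ler_expR oppr_le0 powR_ge0.
Qed.

Lemma hazard_ge1 x n : 1 <= hazard x n.
Proof.
rewrite /hazard invf_ge1 ?subr_gt0 ?weibull_cdf_lt1//.
by rewrite lerBlDr lerDl weibull_cdf_ge0.
Qed.

Lemma hazard_fun_gt0 x n : 0 < hazard x n.
Proof. exact: lt_le_trans (hazard_ge1 x n). Qed.

Lemma weibull_cdf_hazard x n : F (thr x n) = 1 - (hazard x n)^-1.
Proof. by rewrite /hazard invrK subKr. Qed.

Lemma hazard_sumS x n : hazard_sum x n.+1 = hazard_sum x n + hazard x n.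
Proof. by rewrite /hazard_sum big_nat_recr. Qed.

Lemma hazard_sum_ge x n : n%:R <= hazard_sum x n.
Proof.
elim: n => [|n IH]; first by rewrite /hazard_sum big_geq.
by rewrite -natr1 hazard_sumS lerD// hazard_ge1.
Qed.

Lemma hazard_sum_gt0 x n : 0 < hazard_sum x n.+1.
Proof. by apply: lt_le_trans (hazard_sum_ge x n.+1). Qed.

Lemma hazard_sum_ge0 x n : 0 <= hazard_sum x n.
Proof. by apply: le_trans (hazard_sum_ge x n). Qed.

Lemma running_mean_smean x n : running_mean beta x n.+1 = smean x n.
Proof. by rewrite /running_mean -selection_sum. Qed.

Lemma normalized_time_stime x n :
  normalized_time F beta x n.+1 = (stime x n)%:R / hazard_sum x n.
Proof.
have E : \sum_(1 <= j < n.+1) (1 - F (beta * running_mean beta x j))^-1 =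
    hazard_sum x n.
  rewrite big_add1; apply: eq_bigr => j _.
  by rewrite /hazard /threshold running_mean_smean.
by rewrite /normalized_time E.
Qed.

Lemma svalue_gt_threshold x n : increasing x n.+1 -> thr x n < svalue x n.+1.
Proof.
rewrite increasing_stimesS => /andP[_]; rewrite /svalue.
case E : (stime x n.+1) => [//|u] _; move/eqP : E.
by rewrite stimeS next_exceedanceE => /and3P[].
Qed.

Lemma smeanS x n :
  smean x n.+1 = (smean x n * n.+1%:R + svalue x n.+1) / n.+2%:R.
Proof. by rewrite /smean ssumS divfK. Qed.

Lemma good_path_increasing x n : good_path x -> increasing x n.
Proof.
move=> [_ _ xM]; elim: n => [//|n IH]; rewrite increasing_stimesS IH/=.
rewrite stimeS /next_exceedance; case: pselect => [ex_i|nex].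
  by case: ex_minnP => m /andP[].
exfalso; apply: nex.
have [i ni Mi] := xM (stime x n) (Num.truncn (thr x n)).+1.
by exists i.+1; rewrite ltnS ni/= (lt_trans (truncnS_gt _)).
Qed.

Lemma good_path_stimeS x n : good_path x -> (stime x n < stime x n.+1)%N.
Proof.
by move=> gx; have := good_path_increasing n.+1 gx; rewrite increasing_stimesS => /andP[].
Qed.

Lemma good_path_stime_ge1 x n : good_path x -> (1 <= stime x n)%N.
Proof.
move=> gx; elim: n => [//|n IH].
by rewrite (leq_trans IH)// ltnW// good_path_stimeS.
Qed.

Lemma good_path_svalue x n : good_path x -> beta * smean x n <= svalue x n.+1.
Proof. by move=> gx; rewrite ltW// svalue_gt_threshold// good_path_increasing. Qed.

Lemma smean0 x : smean x 0 = x 0%N.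
Proof. by rewrite /smean divr1. Qed.

Lemma good_path_smean0 x : good_path x -> 0 < smean x 0.
Proof. by move=> [_ x0 _]; rewrite smean0. Qed.

Lemma good_path_smean_gt0 x n : good_path x -> 0 < smean x n.
Proof.
move=> gx; apply: (mean_gt0 beta_gt1 (good_path_smean0 gx) (smeanS x)).
by move=> k; exact: good_path_svalue.
Qed.

Lemma good_path_hazard x n : good_path x ->
  hazard x n = expR ((beta * smean x n) `^ alpha).
Proof.
move=> gx; rewrite /hazard /threshold /weibull_cdf ifT ?subKr ?expRN ?invrK//.
by rewrite mulr_ge0 ?(ltW (good_path_smean_gt0 _ gx))// ltW// (lt_trans ltr01).
Qed.

Lemma good_path_hazard_incr x n : good_path x -> hazard x n <= hazard x n.+1.
Proof.
move=> gx; rewrite !good_path_hazard// ler_expR.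
have [c c0 h] := hazard_increment_lower alpha_gt0 beta_gt1 (good_path_smean0 gx)
  (smeanS x) (fun k => good_path_svalue k gx).
by rewrite -subr_ge0; apply: le_trans (h n); rewrite mulr_ge0 ?powR_ge0 ?(ltW c0).
Qed.

Lemma hazard_past n j : (j <= n)%N -> depends_on_past beta n (hazard ^~ j).
Proof. by move=> jn x x' vx xx'; rewrite /hazard (threshold_past jn vx xx'). Qed.

Lemma hazard_sum_past n j : (j <= n.+1)%N -> depends_on_past beta n (hazard_sum ^~ j).
Proof.
move=> jn x x' vx xx'; apply: eq_big_nat => i /andP[_ ij].
by apply: (hazard_past _ vx xx'); rewrite -ltnS (leq_trans ij).
Qed.

Lemma smean_past n j : (j <= n)%N -> depends_on_past beta n (smean ^~ j).
Proof. by move=> jn x x' vx xx'; rewrite /smean (ssum_past jn vx xx'). Qed.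

Lemma smean_measurable n : path_measurable (smean ^~ n).
Proof.
move=> d T x mx; apply: measurable_funM => //; exact: ssum_measurable.
Qed.

Lemma weibull_cdf_measurable : measurable_fun setT (F : R -> R).
Proof.
apply: measurable_fun_ifT => //; first exact: measurable_fun_ler.
apply: measurable_funB => //; apply: (measurableT_comp (@measurable_expR R)).
by apply: measurableT_comp => //; exact: measurable_powR.
Qed.

Lemma hazard_measurable n : path_measurable (hazard ^~ n).
Proof.
move=> d T x mx; apply: measurable_inv_ge0 => [w|].
  by rewrite subr_ge0 ltW// weibull_cdf_lt1.
apply: measurable_funB => //; apply: (measurableT_comp weibull_cdf_measurable).
exact: threshold_measurable.
Qed.

Lemma hazard_sum_measurable n : path_measurable (hazard_sum ^~ n).
Proof. by move=> d T x mx; apply: measurable_sum => j; exact: hazard_measurable. Qed.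

End good_paths.

(** * Second moments *)

Section weibull_observations.
Context d (T : measurableType d) (R : realType) (P : probability T R).
Variables (X : nat -> {RV P >-> R}) (alpha beta : R).
Hypotheses (alpha_gt0 : 0 < alpha) (beta_gt1 : 1 < beta).
Hypothesis X_indep : mutually_independent X.
Hypothesis X_ge0 : forall i, \forall w \ae P, 0 <= X i w.
Hypothesis X_cdf : forall i x, cdf (X i) x = (weibull_cdf alpha x)%:E.
Implicit Types (x : nat -> R) (n : nat) (w : T).

Local Notation F := (weibull_cdf alpha).
Local Notation path w := (X ^~ w).
Local Notation stime := (stime beta).
Local Notation smean := (smean beta).
Local Notation svalue := (svalue beta).
Local Notation thr := (threshold beta).
Local Notation increasing := (increasing_stimes beta).
Local Notation hazard := (hazard alpha beta).
Local Notation hazard_sum := (hazard_sum alpha beta).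

Lemma ae_good_path : {ae P, forall w, good_path (path w)}.
Proof.
have pos : {ae P, forall w, 0 < X 0%N w}.
  exists (X 0%N @^-1` `]-oo, 0]); split.
  - by rewrite -[_ @^-1` _]setTI; exact: measurable_funP.
  - have := X_cdf 0 0; rewrite /cdf /distribution /pushforward => ->.
    by rewrite /weibull_cdf lexx powR0 ?gt_eqF// oppr0 expR0 subrr.
  - by move=> w /= /negP; rewrite -leNgt /preimage/= in_itv.
have unb := observations_unbounded X_indep X_cdf (weibull_cdf_lt1 alpha).
have nonneg := ae_foralln X_ge0.
by move: pos unb nonneg; apply: filterS3 => w h1 h2 h3; split.
Qed.

Lemma path_EFin_measurable (f : (nat -> R) -> R) :
  path_measurable f -> measurable_fun setT (fun w => (f (path w))%:E).
Proof. by move=> mf; apply/measurable_EFinP; exact: mf. Qed.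

(** The case of [integral_waiting_le] in which [z] is the threshold itself: the selected value
    always passes this test, and the success probability is the inverse hazard. *)
Lemma integral_gap_le n (f : nat -> (nat -> R) -> R) (h Psi : (nat -> R) -> R) :
  (forall g, path_measurable (f g)) -> (forall g, depends_on_past beta n (f g)) ->
  (forall g x, 0 <= f g x) ->
  path_measurable h -> (forall x, 0 <= h x) ->
  path_measurable Psi -> (forall x, 0 <= Psi x) ->
  (forall x g, stime x n.+1 = (stime x n + g.+1)%N -> Psi x <= f g x) ->
  (forall x N, \sum_(0 <= g < N)
     f g x * (1 - (hazard x n)^-1) ^+ g * (hazard x n)^-1 <= h x) ->
  (\int[P]_w (Psi (path w))%:E <= \int[P]_w (h (path w))%:E)%E.
Proof.
move=> mf lf f0 mh h0 mPsi Psi0 Psif fh.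
apply: (@integral_waiting_le _ _ _ _ X F beta X_indep X_cdf n f (thr ^~ n)) => //.
- exact: threshold_measurable.
- exact: threshold_past.
- move=> x incr; rewrite svalue_gt_threshold// mulr1; apply: Psif.
  move: incr; rewrite increasing_stimesS => /andP[_ lt].
  by rewrite prednK ?subn_gt0// subnKC// ltnW.
- move=> x N; apply: le_trans (fh x N); rewrite le_eqVlt; apply/orP; left; apply/eqP.
  by apply: eq_bigr => g _; rewrite weibull_cdf_hazard opprB addrCA subrr addr0.
- by apply: filterS ae_good_path => w; exact: good_path_increasing.
Qed.

(** The subtracted 1 is T_1, so that the deviation starts at 0. *)
Definition deviation x n : R := (stime x n)%:R - 1 - hazard_sum x n.

Lemma deviation_measurable n : path_measurable (deviation ^~ n).
Proof.
move=> d' T' x mx; apply: measurable_funB; last exact: hazard_sum_measurable.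
by apply: measurable_funB => //; exact: stimer_measurable.
Qed.

Definition share x n : R := hazard x n / hazard_sum x n.+1.

Lemma share_measurable n : path_measurable (share ^~ n).
Proof.
move=> d' T' x mx; apply: measurable_funM; first exact: hazard_measurable.
apply: measurable_inv_ge0; last exact: hazard_sum_measurable.
by move=> w; exact: hazard_sum_ge0.
Qed.

Lemma share_past n j : (j <= n)%N -> depends_on_past beta n (share ^~ j).
Proof.
move=> jn x x' vx xx'; rewrite /share (hazard_past alpha jn vx xx').
by rewrite (hazard_sum_past alpha (_ : j.+1 <= n.+1)%N vx xx').
Qed.

(** Only shares of index below n are constrained, so that the event at n + 1 is known at stage n and
    can be kept as an indicator when the next gap is integrated out. *)
Definition share_within (N delta delta' : R) x n : bool :=
  all (fun j => (j.+1%:R `^ (- delta) / N <= share x j) &&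
                (share x j <= N * j.+1%:R `^ (- delta'))) (iota 0 n).

Section second_moment.
Variables (N delta delta' : R).
Hypotheses (N_ge1 : 1 <= N) (delta'_le : delta' <= delta) (delta_lt1 : delta < 1)
  (delta_lt : delta < 2 * delta').

Local Notation within := (share_within N delta delta').

Lemma share_within_measurable n : path_measurable (within ^~ n).
Proof.
move=> d' T' x mx.
pose b j (w : T') := (j.+1%:R `^ (- delta) / N <= share (x ^~ w) j) &&
  (share (x ^~ w) j <= N * j.+1%:R `^ (- delta')).
have mb j : measurable_fun setT (b j).
  by apply: measurable_and; apply: measurable_fun_ler => //; exact: share_measurable.
exact: (measurable_all (iota 0 n) mb).
Qed.

Lemma share_within_past n j : (j <= n.+1)%N -> depends_on_past beta n (within ^~ j).
Proof.
move=> jn x x' vx xx'; apply: eq_in_all => i; rewrite mem_iota add0n => /= ij.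
by rewrite (share_past (_ : i <= n)%N vx xx')// -ltnS (leq_trans ij).
Qed.

Lemma share_withinS x n : within x n.+1 = within x n &&
  ((n.+1%:R `^ (- delta) / N <= share x n) && (share x n <= N * n.+1%:R `^ (- delta'))).
Proof. by rewrite /share_within -addn1 iotaD add0n all_cat/= andbT addn1. Qed.

Definition restricted_variance n : \bar R :=
  (\int[P]_w ((within (path w) n)%:R *
    (deviation (path w) n / hazard_sum (path w) n) ^+ 2)%:E)%E.

Lemma restricted_variance_measurable n :
  path_measurable (fun x => (within x n)%:R * (deviation x n / hazard_sum x n) ^+ 2).
Proof.
move=> d' T' x mx; apply: measurable_funM.
  by apply: measurable_natr_bool; exact: share_within_measurable.
apply: measurable_funX; apply: measurable_funM; first exact: deviation_measurable.
apply: measurable_inv_ge0; last exact: hazard_sum_measurable.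
by move=> w; exact: hazard_sum_ge0.
Qed.

Lemma restricted_variance_ge0 n : (0 <= restricted_variance n)%E.
Proof. by apply: integral_ge0 => w _; rewrite lee_fin mulr_ge0// sqr_ge0. Qed.

(* Bounds the conditional expectation, given the past, of the integrand of
   [restricted_variance n.+1]. *)
Definition next_variance x n : R :=
  (within x n.+1)%:R * ((deviation x n ^+ 2 + hazard x n ^+ 2) / hazard_sum x n.+1 ^+ 2).

Lemma next_variance_measurable n : path_measurable (next_variance ^~ n).
Proof.
move=> d' T' x mx; apply: measurable_funM.
  by apply: measurable_natr_bool; exact: share_within_measurable.
apply: measurable_funM.
  by apply: measurable_funD; apply: measurable_funX;
    [exact: deviation_measurable|exact: hazard_measurable].
apply: measurable_inv_ge0; first by move=> w; rewrite exprn_ge0// hazard_sum_ge0.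
by apply: measurable_funX; exact: hazard_sum_measurable.
Qed.

Lemma next_variance_ge0 x n : 0 <= next_variance x n.
Proof.
by rewrite mulr_ge0// divr_ge0 ?addr_ge0 ?sqr_ge0.
Qed.

Lemma restricted_variance_next n :
  (restricted_variance n.+1 <= \int[P]_w (next_variance (path w) n)%:E)%E.
Proof.
(* The value of the next integrand when the gap is g + 1; apart from the gap everything in it is
   known at stage n. *)
pose f (g : nat) x := (within x n.+1)%:R *
  (((stime x n)%:R - 1 - hazard_sum x n.+1 + g.+1%:R) ^+ 2 / hazard_sum x n.+1 ^+ 2).
apply: (@integral_gap_le n f (next_variance ^~ n) (fun x => (within x n.+1)%:R *
    (deviation x n.+1 / hazard_sum x n.+1) ^+ 2)).
- move=> g d' T' x mx; apply: measurable_funM.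
    by apply: measurable_natr_bool; exact: share_within_measurable.
  apply: measurable_funM; last first.
    apply: measurable_inv_ge0; first by move=> w; rewrite exprn_ge0// hazard_sum_ge0.
    by apply: measurable_funX; exact: hazard_sum_measurable.
  apply: measurable_funX; apply: measurable_funD => //.
  apply: measurable_funB; last exact: hazard_sum_measurable.
  by apply: measurable_funB => //; exact: stimer_measurable.
- move=> g x x' vx xx'; rewrite /f (share_within_past (leqnn _) vx xx').
  by rewrite (stime_past (leqnn _) vx xx') (hazard_sum_past alpha (leqnn _) vx xx').
- by move=> g x; rewrite /f mulr_ge0// divr_ge0 ?sqr_ge0.
- exact: next_variance_measurable.
- by move=> x; exact: next_variance_ge0.
- exact: restricted_variance_measurable.
- by move=> x; rewrite mulr_ge0// sqr_ge0.
- move=> x g E; rewrite /f ler_wpM2l// expr_div_n ler_wpM2r ?invr_ge0 ?sqr_ge0//.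
  rewrite /deviation E natrD le_eqVlt; apply/orP; left; apply/eqP.
  by congr (_ ^+ 2); ring.
(* Adding the mean gap to [c] gives the current deviation back, so [geometric_sum2_le] produces the
   numerator of [next_variance]. *)
move=> x M; set c : R := (stime x n)%:R - 1 - hazard_sum x n.+1.
have -> : next_variance x n = (within x n.+1)%:R / hazard_sum x n.+1 ^+ 2 *
    ((c + hazard x n) ^+ 2 + hazard x n ^+ 2).
  rewrite /next_variance /deviation /c hazard_sumS opprD addrA subrK.
  by rewrite [_ / _ * _]mulrAC mulrA.
have -> : \sum_(0 <= g < M) f g x * (1 - (hazard x n)^-1) ^+ g * (hazard x n)^-1 =
    (within x n.+1)%:R / hazard_sum x n.+1 ^+ 2 *
    \sum_(0 <= g < M) (c + g.+1%:R) ^+ 2 * (1 - (hazard x n)^-1) ^+ g * (hazard x n)^-1.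
  rewrite mulr_sumr; apply: eq_bigr => g _; rewrite /f -/c.
  by move: (_ ^+ g) (hazard_sum x n.+1 ^+ 2)^-1 => u v; ring.
rewrite ler_wpM2l ?divr_ge0 ?sqr_ge0//.
by apply: geometric_sum2_le; exact: hazard_ge1.
Qed.

Let contraction_ge0 n : 0 <= 1 - n.+1%:R `^ (- delta) / N.
Proof.
have N0 : 0 < N by rewrite (lt_le_trans _ N_ge1).
have d0 : - delta <= 0 by move: delta'_le delta_lt; lra.
rewrite subr_ge0 ler_pdivrMr// mul1r (le_trans _ N_ge1)//.
by rewrite -[leRHS](powRr0 n.+1%:R) ler_powR ?ler1n.
Qed.

(** With r the share, D/(S+a) = (1-r) D/S and (1-r)^2 <= 1-r; the lower bound on r yields the
    contraction, the upper bound the noise. Index 0 is excluded because [hazard_sum] is then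
    empty. *)
Let next_variance_bound x n : (0 < n)%N -> next_variance x n <=
  (1 - n.+1%:R `^ (- delta) / N) *
    ((within x n)%:R * (deviation x n / hazard_sum x n) ^+ 2) +
  (N * n.+1%:R `^ (- delta')) ^+ 2.
Proof.
move=> n0; rewrite /next_variance share_withinS.
have lN := contraction_ge0 n.
case: (within x n) => /=; last by rewrite !mul0r mulr0 add0r sqr_ge0.
case E : (_ && _); last first.
  by rewrite mul0r addr_ge0 ?sqr_ge0// mulr_ge0// mul1r sqr_ge0.
move: E; rewrite !mul1r /share hazard_sumS => /andP[].
have S0 : 0 < hazard_sum x n by case: n n0 {lN} => // n _; exact: hazard_sum_gt0.
move: (_ / N) lN (N * _) (hazard_sum x n) S0 (hazard x n) (hazard_fun_gt0 alpha beta x n).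
move=> l l1 u S S0 a a0 la au.
have Sa : 0 < S + a by rewrite addr_gt0.
rewrite mulrDl lerD//; last first.
  rewrite -expr_div_n lerXn2r ?nnegrE ?divr_ge0 ?(ltW a0) ?(ltW Sa)//.
  by rewrite (le_trans _ au)// divr_ge0// ltW.
have -> : deviation x n ^+ 2 / (S + a) ^+ 2 =
    (1 - a / (S + a)) ^+ 2 * (deviation x n / S) ^+ 2.
  by field; do ?[apply/andP; split]; apply: lt0r_neq0.
rewrite ler_wpM2r ?sqr_ge0//.
have r0 : 0 <= a / (S + a) by rewrite divr_ge0// ltW.
have r1 : a / (S + a) <= 1 by rewrite ler_pdivrMr// mul1r lerDr ltW.
by move: (a / (S + a)) r0 r1 la => r r0 r1 la; nra.
Qed.

Let next_variance0_le1 x : next_variance x 0 <= 1.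
Proof.
rewrite /next_variance; case: (within x 1) => /=; last by rewrite mul0r.
rewrite mul1r /deviation hazard_sumS /hazard_sum big_geq// subr0 subrr expr0n/= !add0r.
by rewrite divff// expf_neq0// gt_eqF// hazard_fun_gt0.
Qed.

Let restricted_variance1_le : (restricted_variance 1 <= 1)%E.
Proof.
apply: (le_trans (restricted_variance_next 0)).
apply: (@le_trans _ _ (\int[P]_w (cst 1%:E w))%E); last first.
  by rewrite integral_cst// mul1e probability_le1.
apply: ge0_le_integral => //.
- by move=> w _; rewrite lee_fin next_variance_ge0.
- by apply: (path_EFin_measurable (@next_variance_measurable 0)).
- by move=> w _; rewrite lee_fin next_variance0_le1.
Qed.

Let restricted_varianceS n : (0 < n)%N -> (restricted_variance n.+1 <=
  (1 - n.+1%:R `^ (- delta) / N)%:E * restricted_variance n +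
  ((N * n.+1%:R `^ (- delta')) ^+ 2)%:E)%E.
Proof.
move=> n0; apply: (le_trans (restricted_variance_next n)).
have lN := contraction_ge0 n.
have mv := path_EFin_measurable (@restricted_variance_measurable n).
rewrite /restricted_variance -ge0_integralZl_EFin//; last first.
  by move=> w _; rewrite lee_fin mulr_ge0// sqr_ge0.
have -> : (((N * n.+1%:R `^ (- delta')) ^+ 2)%:E =
    \int[P]_w (cst ((N * n.+1%:R `^ (- delta')) ^+ 2)%:E w))%E.
  by rewrite integral_cst// [X in (_ * X)%E]probability_setT mule1.
rewrite -ge0_integralD//; last 3 first.
- by move=> w _; rewrite mule_ge0// lee_fin mulr_ge0// sqr_ge0.
- exact: measurable_funeM.
- by move=> w _; rewrite lee_fin sqr_ge0.
apply: ge0_le_integral => //.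
- by move=> w _; rewrite lee_fin next_variance_ge0.
- by apply: (path_EFin_measurable (@next_variance_measurable n)).
- by apply: emeasurable_funD => //; exact: measurable_funeM.
- by move=> w _; rewrite -EFinM -EFinD lee_fin next_variance_bound.
Qed.

Lemma restricted_variance_rate : exists2 M : R, 0 < M &
  forall n, (restricted_variance n.+1 <= (M * n.+1%:R `^ (- (2 * delta' - delta)))%:E)%E.
Proof.
(* Finiteness is propagated along the recursion first, so that [fine] can turn it into one between
   reals. *)
have fin n : restricted_variance n.+1 \is a fin_num.
  rewrite ge0_fin_numE ?restricted_variance_ge0//; elim: n => [|n IH].
    by apply: le_lt_trans restricted_variance1_le _; exact: ltry.
  apply: (le_lt_trans (restricted_varianceS _)) => //.
  rewrite -(@fineK _ (restricted_variance n.+1)) ?ge0_fin_numE ?restricted_variance_ge0//.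
  by rewrite -EFinM -EFinD ltry.
pose v n := fine (restricted_variance n).
have [|n n0|M M0 hM] := @contraction_rate _ v N delta delta' N_ge1 delta'_le delta_lt1 delta_lt.
- by move=> n; rewrite fine_ge0// restricted_variance_ge0.
- case: n n0 => // n _; rewrite -lee_fin EFinD EFinM !fineK//.
  exact: restricted_varianceS.
- by exists M => // n; rewrite -(fineK (fin n)) lee_fin hM.
Qed.

End second_moment.
End weibull_observations.

(** * Almost sure bounds on selected values and shares *)

Section almost_sure_bounds.
Context d (T : measurableType d) (R : realType) (P : probability T R).
Variables (X : nat -> {RV P >-> R}) (alpha beta : R).
Hypotheses (alpha_gt0 : 0 < alpha) (beta_gt1 : 1 < beta).
Hypothesis X_indep : mutually_independent X.
Hypothesis X_ge0 : forall i, \forall w \ae P, 0 <= X i w.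
Hypothesis X_cdf : forall i x, cdf (X i) x = (weibull_cdf alpha x)%:E.
Implicit Types (x : nat -> R) (n : nat).

Local Notation F := (weibull_cdf alpha).
Local Notation path w := (X ^~ w).
Local Notation stime := (stime beta).
Local Notation smean := (smean beta).
Local Notation svalue := (svalue beta).
Local Notation thr := (threshold beta).
Local Notation hazard := (hazard alpha beta).
Local Notation hazard_sum := (hazard_sum alpha beta).
Local Notation share := (share alpha beta).
Local Notation gamma := (alpha * (beta - 1)).

Let good := ae_good_path alpha_gt0 X_indep X_ge0 X_cdf.

Section large_selected_value.
Variable eta : R.
Hypothesis eta_gt0 : 0 < eta.

(** The indicator of a lower bound on the first observation makes the decay rate deterministic;
    letting K vary over the integers recovers almost every path. *)
Let excess K n x : R :=
  (K.+1%:R^-1 <= smean x 0)%R%:R * ((beta + eta) * smean x n < svalue x n.+1)%R%:R.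

(** The hazard is the inverse of the tail at the threshold, so the last two factors form the
    conditional probability that an accepted observation exceeds the higher level. *)
Let excess_bound K n x : R :=
  (K.+1%:R^-1 <= smean x 0)%R%:R * hazard x n * (1 - F ((beta + eta) * smean x n)).

Let excess_measurable K n : path_measurable (excess K n).
Proof.
move=> d' T' x mx; apply: measurable_funM; apply: measurable_natr_bool.
  by apply: measurable_fun_ler => //; exact: smean_measurable.
apply: measurable_fun_ltr; last exact: svalue_measurable.
by apply: measurable_funM => //; exact: smean_measurable.
Qed.

Let excess_bound_measurable K n : path_measurable (excess_bound K n).
Proof.
move=> d' T' x mx; apply: measurable_funM.
  apply: measurable_funM; last exact: hazard_measurable.
  apply: measurable_natr_bool.
  by apply: measurable_fun_ler => //; exact: smean_measurable.
apply: measurable_funB => //; apply: (measurableT_comp (weibull_cdf_measurable alpha)).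
by apply: measurable_funM => //; exact: smean_measurable.
Qed.

Let excess_bound_ge0 K n x : 0 <= excess_bound K n x.
Proof.
by rewrite !mulr_ge0 ?(ltW (hazard_fun_gt0 _ _ _ _))// subr_ge0 ltW// weibull_cdf_lt1.
Qed.

Let integral_excess K n : (\int[P]_w (excess K n (path w))%:E <=
  \int[P]_w (excess_bound K n (path w))%:E)%E.
Proof.
have me := excess_measurable K n; have mh := excess_bound_measurable K n.
have e0 x : 0 <= excess K n x by rewrite mulr_ge0.
have h0 x : 0 <= excess_bound K n x by exact: excess_bound_ge0.
apply: (@integral_waiting_le _ _ _ _ X F beta X_indep X_cdf n
  (fun _ x => (K.+1%:R^-1 <= smean x 0)%R%:R) (fun x => (beta + eta) * smean x n)) => //.
- move=> _ d' T' x mx; apply: measurable_natr_bool.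
  by apply: measurable_fun_ler => //; exact: smean_measurable.
- by move=> _ x x' vx xx'; rewrite (smean_past (leq0n n) vx xx').
- by move=> d' T' x mx; apply: measurable_funM => //; exact: smean_measurable.
- by move=> x x' vx xx'; rewrite (smean_past (leqnn n) vx xx').
- move=> x N; rewrite /excess_bound -mulr_suml ler_wpM2r//.
    by rewrite subr_ge0 ltW// weibull_cdf_lt1.
  rewrite -mulr_sumr ler_wpM2l//.
  have a0 := hazard_fun_gt0 alpha beta x n.
  rewrite -[leRHS]mul1r -ler_pdivrMr// mulr_suml weibull_cdf_hazard.
  have q01 : 0 <= 1 - (hazard x n)^-1 <= 1.
    by rewrite -weibull_cdf_hazard weibull_cdf_ge0/= ltW// weibull_cdf_lt1.
  (* At k = 0 this says that the geometric weights have total mass at most 1. *)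
  have := geometric_tail_le 0 N q01; rewrite expr0; apply: le_trans.
  rewrite le_eqVlt; apply/orP; left; apply/eqP; apply: eq_bigr => g _.
  by rewrite mul1r opprB addrCA subrr addr0.
- by apply: filterS good => w; exact: good_path_increasing.
Qed.

(** Raising the level from beta to beta + eta multiplies the exponent of the Weibull tail by [kappa]
    + 1, so the conditional excess probability is the exponential of minus [kappa] times that
    exponent. *)
Let kappa := ((beta + eta) / beta) `^ alpha - 1.

Let kappa_gt0 : 0 < kappa.
Proof.
have b0 : 0 < beta by apply: lt_trans beta_gt1.
have p1 : 1 `^ alpha = 1 :> R by rewrite powR1.
rewrite subr_gt0 -[ltLHS]p1; apply: gt0_ltr_powR => //.
- by rewrite nnegrE.
- by rewrite nnegrE divr_ge0 ?addr_ge0// ltW.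
- by rewrite ltr_pdivlMr// mul1r ltrDl.
Qed.

Let rate K := kappa * (beta * K.+1%:R^-1 / (1 + beta) `^ (beta - 1)) `^ alpha.

Let excess_bound_le K n x : good_path x ->
  excess_bound K n x <= expR (- (rate K * n.+1%:R `^ gamma)).
Proof.
move=> gx; rewrite /excess_bound.
have [hK|_] := boolP (_ <= smean x 0); last by rewrite !mul0r expR_ge0.
have b0 : 0 < beta by apply: lt_trans beta_gt1.
have m0 := good_path_smean_gt0 beta_gt1 n gx.
have z0 : 0 <= (beta + eta) * smean x n.
  by rewrite mulr_ge0 ?addr_ge0 ?(ltW m0) ?(ltW b0)// ltW.
rewrite mul1r (good_path_hazard alpha beta_gt1)// /weibull_cdf z0 subKr -expRD ler_expR.
set L := (beta * smean x n) `^ alpha.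
have -> : ((beta + eta) * smean x n) `^ alpha = (kappa + 1) * L.
  have bm0 : 0 <= beta * smean x n by rewrite mulr_ge0 ?(ltW b0) ?(ltW m0).
  have r0 : 0 <= (beta + eta) / beta by rewrite divr_ge0 ?addr_ge0 ?(ltW b0) ?(ltW eta_gt0).
  rewrite /kappa subrK /L -powRM//.
  by congr (_ `^ _); field; rewrite gt_eqF.
have -> : L - (kappa + 1) * L = - (kappa * L) by ring.
rewrite lerN2 /rate -mulrA ler_pM2l//.
have := hazard_lower alpha_gt0 beta_gt1 (good_path_smean0 beta gx) (smeanS beta x)
  (fun k => good_path_svalue beta k gx) n.
apply: le_trans; rewrite ler_wpM2r ?powR_ge0//.
have w0 : 0 < (1 + beta) `^ (beta - 1) by rewrite powR_gt0// addr_gt0.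
apply: ge0_ler_powR; rewrite ?nnegrE ?(ltW alpha_gt0)//.
- by rewrite divr_ge0 ?mulr_ge0 ?invr_ge0 ?(ltW b0) ?(ltW w0).
- rewrite divr_ge0 ?(ltW w0)// mulr_ge0 ?(ltW b0)//.
  exact: ltW (good_path_smean0 beta gx).
- by rewrite ler_pM2r ?invr_gt0// ler_pM2l.
Qed.

Lemma ae_svalue_le : {ae P, forall w, exists n0, forall n, (n0 <= n)%N ->
  svalue (path w) n.+1 <= (beta + eta) * smean (path w) n}.
Proof.
have b0 : 0 < beta by apply: lt_trans beta_gt1.
have g0 : 0 < gamma by rewrite mulr_gt0// subr_gt0.
have key K : {ae P, forall w, excess K n (path w) @[n --> \oo] --> (0 : R)}.
  have r0 : 0 < rate K.
    rewrite mulr_gt0// powR_gt0// divr_gt0 ?mulr_gt0 ?invr_gt0// powR_gt0//.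
    by rewrite addr_gt0.
  have [K' hK'] := expRN_powR_le r0 g0 (ltr0Sn R 1).
  have K'0 : 0 <= K'.
    by have := hK' 0%N; rewrite !powR1/= !mulr1; exact: le_trans (expR_ge0 _).
  have [C hC] := @powR_series_bounded R 2 (ltr1n R 2).
  apply: (@ae_cvg0_of_summable _ _ _ _ (fun n w => excess K n (path w)) (K' * C)).
  - by move=> n; exact: excess_measurable.
  - by move=> n w; rewrite mulr_ge0.
  move=> N; apply: (@le_trans _ _ (\sum_(0 <= n < N) (K' * n.+1%:R `^ (- 2))%:E)%E).
    apply: lee_sum => n _; apply: (le_trans (integral_excess K n)).
    apply: (@le_trans _ _ (\int[P]_w (cst (K' * n.+1%:R `^ (- 2))%:E w))%E).
      apply: ae_ge0_le_integral => //.
      - by move=> w _; rewrite lee_fin.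
      - by apply/measurable_EFinP; exact: excess_bound_measurable.
      - by move=> w _; rewrite lee_fin mulr_ge0// powR_ge0.
      by apply: filterS good => w gw _; rewrite lee_fin (le_trans (excess_bound_le K n gw)).
    by rewrite integral_cst// [X in (_ * X)%E]probability_setT mule1.
  by rewrite sumEFin lee_fin -mulr_sumr ler_wpM2l.
have := ae_foralln key; apply: filterS2 good => w gw hw.
pose K := Num.truncn (smean (path w) 0)^-1.
have hK : K.+1%:R^-1 <= smean (path w) 0.
  have m0 := good_path_smean0 beta gw.
  by rewrite -[leRHS]invrK lef_pV2 ?posrE ?invr_gt0// ltW// truncnS_gt.
(* A 0-1 variable at distance less than 1 from 0 vanishes. *)
move/cvgrPdist_lt : (hw K) => /(_ 1 ltr01)[n0 _ h].
exists n0 => n n0n; rewrite leNgt; apply/negP => lt.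
by have := h n n0n; rewrite /= sub0r normrN /excess hK lt mulr1 normr1 ltxx.
Qed.

(** The lower bound on hazard increments bounds the shares from below. The upper bound holds only
    with beta + eta in place of beta and bounds them from above, whence two different exponents. One
    integer dominates both path-dependent constants. *)
Lemma ae_share_within : alpha * (beta + eta - 1) < 1 ->
  {ae P, forall w, exists N : nat, forall n,
    share_within alpha beta N.+1%:R (1 - gamma) (1 - alpha * (beta + eta - 1)) (path w) n}.
Proof.
move=> g1; set g' := alpha * (beta + eta - 1) in g1 *.
have b0 : 0 < beta by apply: lt_trans beta_gt1.
have g0 : 0 < gamma by rewrite mulr_gt0// subr_gt0.
have gg' : gamma <= g' by rewrite /g' ler_pM2l// lerD2r lerDl ltW.
apply: filterS2 good ae_svalue_le => w gw [n0 hn0].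
pose x := path w.
pose L n := (beta * smean x n) `^ alpha.
have aE n : hazard x n = expR (L n) by rewrite (good_path_hazard alpha beta_gt1).
have SE n : hazard_sum x n = \sum_(0 <= j < n) expR (L j).
  by apply: eq_bigr => j _; rewrite aE.
have [c c0 hc] := hazard_increment_lower alpha_gt0 beta_gt1 (good_path_smean0 beta gw)
  (smeanS beta x) (fun k => good_path_svalue beta k gw).
have [C C0 hC] := hazard_increment_upper alpha_gt0 beta_gt1 (good_path_smean0 beta gw)
  (smeanS beta x) (fun k => good_path_svalue beta k gw)
  (ltW (ltr_pwDr eta_gt0 (lexx beta))) (ltW g1) hn0.
have [C1 C10 hC1] : exists2 C, 0 < C & forall n,
    hazard_sum x n.+1 / hazard x n <= C * n.+1%:R `^ (1 - gamma).
  have [| |C1 C10 h] := @hazard_ratio_upper _ L c (1 - gamma) c0.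
  - by apply/andP; split; lra.
  - by move=> n; rewrite opprB; exact: hc.
  by exists C1 => // n; rewrite SE aE.
have [c1 c10 hc1] : exists2 c, 0 < c & forall n,
    c * n.+1%:R `^ (1 - g') <= hazard_sum x n.+1 / hazard x n.
  have [| |c1 c10 h] := @hazard_ratio_lower _ L C (1 - g') C0.
  - by apply/andP; split; lra.
  - by move=> n; rewrite opprB; exact: hC.
  by exists c1 => // n; rewrite SE aE.
pose N := Num.truncn (Num.max C1 c1^-1).
have N1 : C1 <= N.+1%:R.
  by apply: le_trans (ltW (truncnS_gt _)); rewrite le_max lexx.
have N2 : c1^-1 <= N.+1%:R.
  by apply: le_trans (ltW (truncnS_gt _)); rewrite le_max lexx orbT.
exists N => n; apply/allP => j _.
have r0 : 0 < hazard_sum x j.+1 / hazard x j.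
  by rewrite divr_gt0 ?hazard_sum_gt0 ?hazard_fun_gt0.
have shareE : share x j = (hazard_sum x j.+1 / hazard x j)^-1 by rewrite invf_div.
rewrite shareE; move: (_ / hazard x j) r0 (hC1 j) (hc1 j) => r r0 h1 h2.
have w0 p : 0 < j.+1%:R `^ p :> R by rewrite powR_gt0.
rewrite !powRN -[in X in X && _]invfM; apply/andP; split.
  rewrite lef_pV2 ?posrE// ?mulr_gt0// (le_trans h1)// mulrC.
  by rewrite ler_pM2l.
rewrite -[N.+1%:R]invrK -invfM lef_pV2 ?posrE// ?mulr_gt0 ?invr_gt0//.
apply: le_trans h2; rewrite ler_pM2r//.
by rewrite -[leRHS]invrK lef_pV2 ?posrE ?invr_gt0.
Qed.

End large_selected_value.

End almost_sure_bounds.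

(** * Convergence to 1 *)

Section convergence_to_one.
Context d (T : measurableType d) (R : realType) (P : probability T R).
Variables (X : nat -> {RV P >-> R}) (alpha beta : R).
Hypotheses (alpha_gt0 : 0 < alpha) (beta_gt1 : 1 < beta).
Hypothesis X_indep : mutually_independent X.
Hypothesis X_ge0 : forall i, \forall w \ae P, 0 <= X i w.
Hypothesis X_cdf : forall i x, cdf (X i) x = (weibull_cdf alpha x)%:E.
Implicit Types (x : nat -> R) (n : nat).

Local Notation F := (weibull_cdf alpha).
Local Notation path w := (X ^~ w).
Local Notation stime := (stime beta).
Local Notation hazard := (hazard alpha beta).
Local Notation hazard_sum := (hazard_sum alpha beta).
Local Notation share := (share alpha beta).
Local Notation deviation := (deviation alpha beta).
Local Notation gamma := (alpha * (beta - 1)).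

Let good := ae_good_path alpha_gt0 X_indep X_ge0 X_cdf.

Let gamma_gt0 : 0 < gamma. Proof. by rewrite mulr_gt0// subr_gt0. Qed.

Lemma stime_ratioE x n : (0 < n)%N ->
  (stime x n)%:R / hazard_sum x n =
  1 + (hazard_sum x n)^-1 + deviation x n / hazard_sum x n.
Proof.
case: n => // n _; rewrite /deviation; have := hazard_sum_gt0 alpha beta x n.
by move: (hazard_sum x n.+1) => S S0; field; rewrite gt_eqF.
Qed.

Let stime_homo x : good_path x ->
  {homo (fun n => (stime x n)%:R : R) : m n / (m <= n)%N >-> m <= n}.
Proof.
move=> gx; apply: homo_leq => [//|y|n]; first exact: le_trans.
by rewrite ler_nat ltnW// good_path_stimeS.
Qed.

Let hazard_sum_homo x : {homo hazard_sum x : m n / (m <= n)%N >-> m <= n}.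
Proof.
apply: homo_leq => [//|y|n]; first exact: le_trans.
by rewrite hazard_sumS lerDl ltW// hazard_fun_gt0.
Qed.

Lemma ae_stime_ratio_cvg1 : gamma < 2^-1 ->
  {ae P, forall w, (stime (path w) n)%:R / hazard_sum (path w) n @[n --> \oo] --> (1 : R)}.
Proof.
(* This eta gives away a quarter of the slack 1/2 - gamma. Then 1 - g' > 1/2, and 2(1 - g') - (1 -
   gamma) = 1 - gamma - (1/2 - gamma)/2 still exceeds 1/2, as summability along squares requires. *)
move=> g2; pose eta := (2^-1 - gamma) / (4 * alpha).
have eta0 : 0 < eta by rewrite divr_gt0 ?subr_gt0// mulr_gt0.
have aeta : alpha * eta = (2^-1 - gamma) / 4 by rewrite /eta; field; rewrite gt_eqF.
have g'E : alpha * (beta + eta - 1) = gamma + (2^-1 - gamma) / 4 by rewrite -aeta; ring.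
set g' := alpha * (beta + eta - 1) in g'E.
have half : 2 * 2^-1 = 1 :> R by rewrite mulfV.
have gp := gamma_gt0.
have [hd' [hg1 hd1 hd2 hd3 hk]] : 2^-1 < 1 - g' /\ [/\ g' < 1, 1 - g' <= 1 - gamma,
    1 - gamma < 1, 1 - gamma < 2 * (1 - g') & 1 < 2 * (2 * (1 - g') - (1 - gamma))].
  by move: half gp g2; rewrite g'E; move: gamma (2^-1) => g h; split; [lra|split; lra].
pose V N j w : R := (share_within alpha beta N.+1%:R (1 - gamma) (1 - g') (path w) (j.+1 ^ 2))%:R *
   (deviation (path w) (j.+1 ^ 2) / hazard_sum (path w) (j.+1 ^ 2)) ^+ 2.
have key N : {ae P, forall w, V N j w @[j --> \oo] --> (0 : R)}.
  have [M M0 hM] := restricted_variance_rate beta alpha_gt0 X_indep X_ge0 X_cdf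
    (ler1n R N.+1) hd1 hd2 hd3.
  have [C hC] := powR_series_bounded hk.
  apply: (@ae_cvg0_of_summable _ _ _ _ (V N) (M * C)) => [j|j w|K].
  - exact: (restricted_variance_measurable _ _ _).
  - by rewrite mulr_ge0// sqr_ge0.
  apply: (@le_trans _ _ (\sum_(0 <= j < K)
      (M * j.+1%:R `^ (- (2 * (2 * (1 - g') - (1 - gamma)))))%:E)%E).
    apply: lee_sum => j _; have := hM (j.+1 ^ 2).-1.
    by rewrite prednK ?expn_gt0// natrX -powR_mulrn// -powRrM mulrN.
  by rewrite sumEFin lee_fin -mulr_sumr ler_wpM2l// ltW.
have := ae_foralln key.
have := ae_share_within alpha_gt0 beta_gt1 X_indep X_ge0 X_cdf eta0 hg1.
(* The integer N now depends on the path; for this N the indicator in [V] is 1 at every index. *)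
apply: filterS3 good => w gw [N hN] /(_ N) hV.
have Dcvg : deviation (path w) (j.+1 ^ 2) / hazard_sum (path w) (j.+1 ^ 2) @[j --> \oo] --> (0 : R).
  apply/cvgrPdist_le => e e0; move/cvgrPdist_le : hV => /(_ (e ^+ 2) (exprn_gt0 _ e0)).
  apply: filterS => j; rewrite !sub0r !normrN /V hN mul1r ger0_norm ?sqr_ge0//.
  move=> h; rewrite -(@ler_pXn2r _ 2) ?nnegrE ?(ltW e0)//.
  by rewrite real_normK ?num_real.
have Scvg : (hazard_sum (path w) (j.+1 ^ 2))^-1 @[j --> \oo] --> (0 : R).
  apply: (@squeeze_cvgr _ _ _ _ (fun=> 0) (fun j => j.+1%:R `^ (- 1))).
  - apply: nearW => j; rewrite invr_ge0 hazard_sum_ge0/= powR_inv1// lef_pV2 ?posrE//.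
      apply: le_trans (hazard_sum_ge _ _ _ _); rewrite ler_nat.
      by rewrite -mulnn leq_pmulr.
    by apply: lt_le_trans (hazard_sum_ge _ _ _ _); rewrite ltr0n expn_gt0.
  - exact: cvg_cst.
  - exact: powRN_natr_cvg0.
apply: cvg_ratio_squares.
- by [].
- by move=> n; exact: hazard_sum_gt0.
- exact: stime_homo.
- exact: hazard_sum_homo.
- rewrite -(cvg_shiftS (fun n => (stime (path w) (n ^ 2))%:R / hazard_sum (path w) (n ^ 2))).
  rewrite (_ : [sequence _]_n = (fun j => 1 + (hazard_sum (path w) (j.+1 ^ 2))^-1 +
      deviation (path w) (j.+1 ^ 2) / hazard_sum (path w) (j.+1 ^ 2))); last first.
    by apply/funext => j /=; rewrite stime_ratioE ?expn_gt0.
  have h := cvgD (cvgD (cvg_cst (1 : R)) Scvg) Dcvg; rewrite !addr0 in h; exact: h.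
- apply: (@partial_sum_ratio_squares _ (hazard (path w)) N.+1%:R (1 - g')) => //.
    by move=> n; exact: hazard_fun_gt0.
  by move=> n; have /allP/(_ n) := hN n.+1; rewrite mem_iota ltnSn => /(_ isT)/andP[].
Qed.

Lemma normalized_time_measurable k :
  path_measurable (fun x => normalized_time F beta x k).
Proof.
move=> d' T' x mx; case: k => [|n].
  by under eq_fun do rewrite /normalized_time big_geq// invr0 mulr0; exact: measurable_cst.
under eq_fun do rewrite normalized_time_stime.
apply: measurable_funM; first exact: stimer_measurable.
apply: measurable_inv_ge0; last exact: hazard_sum_measurable.
by move=> w; exact: hazard_sum_ge0.
Qed.

Lemma normalized_time_cvg_almost_surely : gamma < 2^-1 ->
  cvg_almost_surely P (fun k w => normalized_time F beta (path w) k) 1.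
Proof.
move=> g2; apply: filterS (ae_stime_ratio_cvg1 g2) => w h.
rewrite -(cvg_shiftS (fun k => normalized_time F beta (path w) k)).
by under eq_fun do rewrite normalized_time_stime.
Qed.

Lemma chebyshev_le (f : T -> R) (A : set T) (c : R) : measurable A ->
  measurable_fun setT f -> (forall w, 0 <= f w) -> 0 <= c ->
  (forall w, A w -> c <= f w) -> (c%:E * P A <= \int[P]_w (f w)%:E)%E.
Proof.
move=> mA mf f0 c0 cf; rewrite -[A]setIT -integral_indic// -ge0_integralZl_EFin//; last first.
  by apply/measurable_EFinP; exact: measurable_indic.
apply: ge0_le_integral => //.
- by move=> w _; rewrite -EFinM lee_fin mulr_ge0.
- by apply: measurable_funeM; apply/measurable_EFinP; exact: measurable_indic.
- exact/measurable_EFinP.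
move=> w _; rewrite -EFinM lee_fin indicE; have [wA|_] := boolP (w \in A).
  by rewrite mulr1 cf// -inE.
by rewrite mulr0.
Qed.

Lemma normalized_time_cvg_in_probability : gamma < 1 ->
  cvg_in_probability P (fun k w => normalized_time F beta (path w) k) 1.
Proof.
move=> g1; split=> [k|e e0]; first exact: (@normalized_time_measurable k).
(* A quarter of the slack 1 - gamma leaves the exponent 2(1 - g') - (1 - gamma) = (1 - gamma)/2
   positive. *)
pose eta := (1 - gamma) / (4 * alpha).
have eta0 : 0 < eta by rewrite divr_gt0 ?subr_gt0// mulr_gt0.
have aeta : alpha * eta = (1 - gamma) / 4 by rewrite /eta; field; rewrite gt_eqF.
have g'E : alpha * (beta + eta - 1) = gamma + (1 - gamma) / 4 by rewrite -aeta; ring.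
set g' := alpha * (beta + eta - 1) in g'E.
have gp := gamma_gt0.
have [hg1 hd1 hd2 hd3 hk] : [/\ g' < 1, 1 - g' <= 1 - gamma, 1 - gamma < 1,
    1 - gamma < 2 * (1 - g') & 0 < 2 * (1 - g') - (1 - gamma)].
  by move: gp g1; rewrite g'E; move: gamma => g; split; lra.
pose within N := share_within alpha beta N.+1%:R (1 - gamma) (1 - g').
(* These events of bad paths decrease in N to a null event, so some N makes the probability at most
   r/2; off [A N] the restricted variance controls the deviation. *)
pose A N := \bigcup_n [set w | ~~ within N (path w) n].
have mwithin N n : measurable [set w | within N (path w) n].
  have := @share_within_measurable _ alpha beta N.+1%:R (1 - gamma) (1 - g') n _ _ X.
  move=> /(_ (fun i => measurable_funP (X i)) measurableT [set true] I).
  by rewrite setTI; congr measurable; apply/seteqP; split => w /=.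
have mA N : measurable (A N).
  apply: bigcupT_measurable => n.
  rewrite (_ : [set _ | _] = ~` [set w | within N (path w) n]).
    exact: measurableC.
  by apply/seteqP; split => w /= /negP.
have PA : P (A N) @[N --> \oo] --> 0%E.
  have -> : 0%E = P (\bigcap_N A N).
    apply/esym/eqP; rewrite eq_le measure_ge0 andbT.
    have mI : measurable (\bigcap_N A N) by exact: bigcapT_measurable.
    have [B [mB PB hB]] := ae_share_within alpha_gt0 beta_gt1 X_indep X_ge0 X_cdf eta0 hg1.
    rewrite -PB le_measure ?inE// => w Aw; apply: hB => /= -[N hN].
    by have [n _ /=] := Aw N I; rewrite /within hN.
  apply: nonincreasing_cvg_mu => //.
  - by rewrite (le_lt_trans (probability_le1 _ _)) ?ltry.
  - exact: bigcapT_measurable.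
  apply/nonincreasing_seqP => N; apply/subsetPset => w [n _ /= h]; exists n => //=.
  apply: contra h => /allP h; apply/allP => j /h /andP[h1 h2].
  have NN : N.+1%:R <= N.+2%:R :> R by rewrite ler_nat.
  apply/andP; split.
    by apply: le_trans h1; rewrite ler_wpM2l ?powR_ge0// lef_pV2 ?posrE.
  by apply: (le_trans h2); rewrite ler_wpM2r ?powR_ge0.
pose E k := [set w | e < `|normalized_time F beta (path w) k - 1|].
have mE k : measurable (E k).
  have mN : measurable_fun setT (fun w => `|normalized_time F beta (path w) k - 1|).
    apply: measurableT_comp => //; apply: measurable_funB => //.
    exact: (@normalized_time_measurable k).
  have := measurable_fun_ltr (measurable_cst e) mN.
  move=> /(_ measurableT [set true] I); rewrite setTI.
  by congr measurable; apply/seteqP; split => w /=.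
rewrite -(cvg_shiftS (fun k => P (E k))) -(cvg_shiftS (fun k => P (E k.+1))).
apply/fine_cvgP; split; first by apply: nearW => n; rewrite fin_num_measure.
apply/cvgrPdist_le => r r0.
have r20 : 0 < r / 2 by rewrite divr_gt0.
have [N PN] : exists N, (P (A N) <= (r / 2)%:E)%E.
  move/fine_cvgP : PA => [_ /cvgrPdist_le /(_ _ r20)][N _ /(_ N (leqnn N))].
  rewrite /= sub0r normrN ger0_norm ?fine_ge0// => h; exists N.
  by rewrite -(fineK (fin_num_measure P _ (mA N))) lee_fin.
have [M M0 hM] := restricted_variance_rate beta alpha_gt0 X_indep X_ge0 X_cdf
    (ler1n R N.+1) hd1 hd2 hd3.
set k := 2 * (1 - g') - (1 - gamma) in hk hM.
have := @powRN_natr_cvg0 R k hk; move/cvgrPdist_le.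
(* Chosen so that Chebyshev's inequality at level e/2 gives at most r/2. The other e/2 absorbs the
   term 1/S that stems from T_1 = 1. *)
have c0 : 0 < (e / 2) ^+ 2 * (r / 2) / M.
  by rewrite divr_gt0// mulr_gt0// exprn_gt0// divr_gt0.
move=> /(_ _ c0) near1.
have := @powRN_natr_cvg0 R 1 ltr01; move/cvgrPdist_le => /(_ _ (divr_gt0 e0 (ltr0Sn _ 1))).
apply: filterS2 near1 => n; rewrite /= !sub0r !normrN !ger0_norm ?powR_ge0 ?fine_ge0 ?measure_ge0// => h1 h2.
pose G := E n.+2 `&` [set w | within N (path w) n.+1].
have mG : measurable G by exact: measurableI.
have PG : (P G <= (r / 2)%:E)%E.
  have c1 : 0 < (e / 2) ^+ 2 by rewrite exprn_gt0// divr_gt0.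
  rewrite -(@lee_pmul2l _ ((e / 2) ^+ 2)%:E) ?fin_numE// -EFinM.
  apply: (@le_trans _ _ (M * n.+1%:R `^ (- k))%:E); last first.
    by rewrite lee_fin -ler_pdivlMl// mulrC.
  apply: le_trans (hM n); apply: chebyshev_le => //.
  - by apply: (restricted_variance_measurable _ _ _).
  - by move=> w; rewrite mulr_ge0// sqr_ge0.
  - exact: ltW.
  move=> w [/= Ew].
  have -> : within N (path w) n.+1 =
    share_within alpha beta N.+1%:R (1 - gamma) (1 - g') (path w) n.+1 by [].
  move=> ww; rewrite ww mul1r -[leRHS]real_normK ?num_real//.
  rewrite ler_pXn2r ?nnegrE ?divr_ge0 ?(ltW e0)//.
  move: Ew; rewrite /E/= normalized_time_stime stime_ratioE//.
  set D := _ / _; set S := hazard_sum _ _.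
  have S1 : S^-1 <= e / 2.
    apply: le_trans h2; rewrite powR_inv1// lef_pV2 ?posrE//; last exact: hazard_sum_gt0.
    exact: hazard_sum_ge.
  have S2 : 0 <= S^-1 by rewrite invr_ge0 hazard_sum_ge0.
  have -> : 1 + S^-1 + D - 1 = S^-1 + D by ring.
  move=> Ew; have := lt_le_trans Ew (ler_normD _ _); rewrite (ger0_norm S2); lra.
have : (P (E n.+2) <= r%:E)%E.
  rewrite (splitr r) EFinD; apply: le_trans (leeD PG PN).
  apply: (@le_trans _ _ (P (G `|` A N))).
    apply: le_measure; rewrite ?inE//; first exact: measurableU.
    move=> w Ew; have [ww|nw] := boolP (within N (path w) n.+1); first by left.
    by right; exists n.+1.
  exact: measureU2.
by rewrite -[X in (X <= _)%E -> _]fineK ?fin_num_measure// lee_fin.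
Qed.

End convergence_to_one.

(** * Convergence to the exponential distribution *)

(** The maximum gives one formula for both signs of [a], in the form in which the limit of the
    survival probabilities appears. *)
Lemma exponential_cdf (R : realType) (a : R) :
  exponential_prob 1 `]-oo, a] = (1 - expR (- Num.max a 0))%:E.
Proof.
rewrite /exponential_prob.
have -> : (fun x => (exponential_pdf 1 x)%:E) =
    (fun x => (exponential_pdf 1 x)%:E) \_ `[0, +oo[ :> (R -> \bar R).
  apply/funext => x; rewrite patchE; case: ifPn => // x0.
  by rewrite /exponential_pdf patchE (negbTE x0).
rewrite -integral_mkcondr; have [a0|a0] := leP a 0.
  rewrite oppr0 expR0 subrr; apply: (@integral_Sset1 _ _ _ 0) => x /=.
  by rewrite !in_itv/= andbT => -[xa x0]; apply/eqP; rewrite eq_le x0 (le_trans xa).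
rewrite (_ : _ `&` _ = `[0, a]%classic); last first.
  apply/seteqP; split => x /=; rewrite !in_itv/= andbT; first by move=> [-> ->].
  by move=> /andP[-> ->].
have := exponential_prob_itv0c 1 a0; rewrite /exponential_prob => ->.
by rewrite mulN1r.
Qed.

Section convergence_to_exponential.
Context d (T : measurableType d) (R : realType) (P : probability T R).
Variables (X : nat -> {RV P >-> R}) (alpha beta : R).
Hypotheses (alpha_gt0 : 0 < alpha) (beta_gt1 : 1 < beta).
Hypothesis X_indep : mutually_independent X.
Hypothesis X_ge0 : forall i, \forall w \ae P, 0 <= X i w.
Hypothesis X_cdf : forall i x, cdf (X i) x = (weibull_cdf alpha x)%:E.
Hypothesis gamma_gt1 : 1 < alpha * (beta - 1).
Implicit Types (x : nat -> R) (n : nat).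

Local Notation F := (weibull_cdf alpha).
Local Notation path w := (X ^~ w).
Local Notation stime := (stime beta).
Local Notation smean := (smean beta).
Local Notation hazard := (hazard alpha beta).
Local Notation hazard_sum := (hazard_sum alpha beta).
Local Notation gamma := (alpha * (beta - 1)).

Let good := ae_good_path alpha_gt0 X_indep X_ge0 X_cdf.

Let hazard_inv_le x n : good_path x -> (hazard x n.+1)^-1 <= (hazard x n)^-1.
Proof.
move=> gx; have h := good_path_hazard_incr alpha_gt0 beta_gt1 n gx.
have := hazard_fun_gt0 alpha beta x n; have := hazard_fun_gt0 alpha beta x n.+1.
by move: (hazard x n) (hazard x n.+1) h => a b ab b0 a0; rewrite lef_pV2.
Qed.

Let normalized x n : R := (stime x n.+1)%:R / hazard x n.

Let normalized_measurable n : path_measurable (normalized ^~ n).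
Proof.
move=> d' T' x mx; apply: measurable_funM; first exact: stimer_measurable.
apply: measurable_inv_ge0; last exact: hazard_measurable.
by move=> w; rewrite ltW// hazard_fun_gt0.
Qed.

Let normalized_ge0 x n : 0 <= normalized x n.
Proof. by rewrite divr_ge0// ltW// hazard_fun_gt0. Qed.

Let current x n : R := (stime x n)%:R / hazard x n.

Let current_measurable n : path_measurable (current ^~ n).
Proof.
move=> d' T' x mx; apply: measurable_funM; first exact: stimer_measurable.
apply: measurable_inv_ge0; last exact: hazard_measurable.
by move=> w; rewrite ltW// hazard_fun_gt0.
Qed.

Let current_ge0 x n : 0 <= current x n.
Proof. by rewrite divr_ge0// ltW// hazard_fun_gt0. Qed.

(** Given the past, the next gap has mean equal to the hazard, which contributes the 1. *)
Let integral_normalized n :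
  (\int[P]_w (normalized (path w) n)%:E <= \int[P]_w (current (path w) n + 1)%:E)%E.
Proof.
have mn := normalized_measurable n.
have mc : path_measurable (fun x => current x n + 1).
  by move=> d' T' x mx; apply: measurable_funD => //; exact: current_measurable.
apply: (@integral_gap_le _ _ _ _ X alpha beta alpha_gt0 X_indep X_ge0 X_cdf n
  (fun g x => ((stime x n)%:R + g.+1%:R) / hazard x n) (fun x => current x n + 1)
  (fun x => normalized x n)).
- move=> g d' T' x mx; apply: measurable_funM.
    by apply: measurable_funD => //; exact: stimer_measurable.
  apply: measurable_inv_ge0; last exact: hazard_measurable.
  by move=> w; rewrite ltW// hazard_fun_gt0.
- move=> g x x' vx xx'; rewrite (stime_past (leqnn n) vx xx').
  by rewrite (hazard_past alpha (leqnn n) vx xx').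
- by move=> g x; rewrite divr_ge0 ?addr_ge0// ltW// hazard_fun_gt0.
- exact: mc.
- by move=> x; rewrite addr_ge0.
- exact: mn.
- by move=> x; exact: normalized_ge0.
- by move=> x g E; rewrite /normalized E natrD.
move=> x N; have a0 := hazard_fun_gt0 alpha beta x n.
have -> : current x n + 1 = (hazard x n)^-1 * ((stime x n)%:R + hazard x n).
  by rewrite /current; field; rewrite gt_eqF.
have ai0 : 0 <= (hazard x n)^-1 by rewrite invr_ge0 ltW.
have h := geometric_sum1_le N (hazard_ge1 alpha beta x n) (ler0n R (stime x n)).
apply: le_trans (ler_wpM2l ai0 h).
rewrite mulr_sumr le_eqVlt; apply/orP; left; apply/eqP; apply: eq_bigr => g _.
by move: (hazard x n)^-1 => v; move: ((1 - v) ^+ g) => u; ring.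
Qed.

(** As hazards are nondecreasing on good paths, [current] at n + 1 is at most [normalized] at n, so
    each stage adds at most 1 to the expectation. *)
Let integral_normalized_le n : (\int[P]_w (normalized (path w) n)%:E <= n.+2%:R%:E)%E.
Proof.
elim: n => [|n IH]; apply: (le_trans (integral_normalized _)).
  apply: (@le_trans _ _ (\int[P]_w (cst 2%:E w))%E); last first.
    by rewrite integral_cst// [X in (_ * X)%E]probability_setT mule1.
  apply: ge0_le_integral => //.
  - by move=> w _; rewrite lee_fin addr_ge0.
  - apply/measurable_EFinP; apply: measurable_funD => //; exact: current_measurable.
  move=> w _; rewrite lee_fin lerD2r /current mul1r invf_le1 ?hazard_ge1//.
  exact: hazard_fun_gt0.
apply: (@le_trans _ _ (\int[P]_w ((normalized (path w) n)%:E + cst 1%:E w))%E).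
  apply: ae_ge0_le_integral => //.
  - by move=> w _; rewrite lee_fin addr_ge0.
  - apply/measurable_EFinP; apply: measurable_funD => //; exact: current_measurable.
  - by move=> w _; rewrite adde_ge0// lee_fin.
  - by apply: emeasurable_funD => //; apply/measurable_EFinP; exact: normalized_measurable.
  apply: filterS good => w gw _; rewrite -EFinD lee_fin lerD2r.
  rewrite /current /normalized; apply: ler_wpM2l; first exact: ler0n.
  exact: hazard_inv_le.
rewrite ge0_integralD//; last first.
- by apply/measurable_EFinP; exact: normalized_measurable.
- by move=> w _; rewrite lee_fin.
rewrite integral_cst// [X in (_ * X)%E]probability_setT mule1.
by rewrite -[n.+3%:R]natr1 EFinD leeD2r.
Qed.

Let increment_exp x n : good_path x ->
  hazard x n / hazard x n.+1 = expR (- ((beta * smean x n.+1) `^ alpha - (beta * smean x n) `^ alpha)).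
Proof.
move=> gx; rewrite !(good_path_hazard alpha beta_gt1)// opprB expRD expRN; by [].
Qed.

(** For gamma > 1 the logarithms of the hazards grow by at least c n^(gamma-1) per stage, so
    consecutive ratios decay faster than any power. *)
Let increment_cvg x : good_path x ->
  n.+2%:R ^+ 3 * (hazard x n / hazard x n.+1) @[n --> \oo] --> (0 : R).
Proof.
move=> gx.
have [c c0 hc] := hazard_increment_lower alpha_gt0 beta_gt1 (good_path_smean0 beta gx)
  (smeanS beta x) (fun k => good_path_svalue beta k gx).
under eq_fun do rewrite increment_exp//.
have g1 : 0 < gamma - 1 by rewrite subr_gt0.
exact: expRN_increment_cvg0 c0 g1 hc.
Qed.

Lemma ae_stime_hazard_cvg0 :
  {ae P, forall w, (stime (path w) n)%:R / hazard (path w) n @[n --> \oo] --> (0 : R)}.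
Proof.
have [C hC] := @powR_series_bounded R 2 (ltr1n R 2).
(* Expectations of order n become summable after division by the cube; [increment_cvg] pays the cube
   back in passing to the next hazard. *)
have key : {ae P, forall w, normalized (path w) n / n.+2%:R ^+ 3 @[n --> \oo] --> (0 : R)}.
  apply: (@ae_cvg0_of_summable _ _ _ _ (fun n w => normalized (path w) n / n.+2%:R ^+ 3) C).
  - by move=> n; apply: measurable_funM => //; exact: normalized_measurable.
  - by move=> n w; rewrite divr_ge0// exprn_ge0.
  move=> N; apply: (@le_trans _ _ (\sum_(0 <= n < N) (n.+1%:R `^ (- 2))%:E)%E).
    apply: lee_sum => n _; under eq_integral do rewrite mulrC EFinM.
    rewrite ge0_integralZl_EFin//; last 2 first.
    - by move=> w _; rewrite lee_fin.
    - by apply/measurable_EFinP; exact: normalized_measurable.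
    apply: (@le_trans _ _ ((n.+2%:R ^+ 3)^-1%:E * n.+2%:R%:E)%E).
      by apply: lee_wpmul2l => //; rewrite lee_fin invr_ge0 exprn_ge0.
    rewrite -EFinM lee_fin powR_invn//.
    have -> : (n.+2%:R ^+ 3)^-1 * n.+2%:R = n.+2%:R ^- 2 :> R by move: (n.+2%:R) (pnatr_eq0 R n.+2) => z z0; field; rewrite z0.
    by rewrite lef_pV2 ?posrE ?exprn_gt0// lerXn2r ?nnegrE// ler_nat.
  by rewrite sumEFin lee_fin.
apply: filterS2 good key => w gw hw.
rewrite -(cvg_shiftS (fun n => (stime (path w) n)%:R / hazard (path w) n)).
have h := cvgM hw (increment_cvg gw); rewrite mulr0 in h.
rewrite (_ : [sequence _]_n = (fun n => normalized (path w) n / n.+2%:R ^+ 3 *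
   (n.+2%:R ^+ 3 * (hazard (path w) n / hazard (path w) n.+1)))); first exact: h.
apply/funext => n /=; rewrite mulrA divfK ?expf_neq0// /normalized mulrA divfK//.
by rewrite gt_eqF// hazard_fun_gt0.
Qed.

(** Monotonicity bounds the earlier hazards by their number times the largest one, which is
    negligible against the next hazard. *)
Lemma ae_hazard_sum_ratio_cvg1 :
  {ae P, forall w, hazard_sum (path w) n.+1 / hazard (path w) n @[n --> \oo] --> (1 : R)}.
Proof.
apply: filterS good => w gw; set x := path w.
have h0 : hazard_sum x n / hazard x n @[n --> \oo] --> (0 : R).
  rewrite -(cvg_shiftS (fun n => hazard_sum x n / hazard x n)).
  apply: (@squeeze_cvgr _ _ _ _ (fun=> 0)
     (fun n => n.+2%:R ^+ 3 * (hazard x n / hazard x n.+1))).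
  - apply: nearW => n /=.
    have a0 := hazard_fun_gt0 alpha beta x n; have a1 := hazard_fun_gt0 alpha beta x n.+1.
    have ai1 : 0 < (hazard x n.+1)^-1 by rewrite invr_gt0.
    have s1 := hazard_sum_ge0 alpha beta x n.+1.
    rewrite mulr_ge0 ?(ltW ai1)//= mulrA ler_pM2r//.
    apply: (@le_trans _ _ (n.+1%:R * hazard x n)).
      elim: n {a0 a1 ai1 s1} => [|n IH]; first by rewrite hazard_sumS /hazard_sum big_geq// add0r mul1r.
      rewrite hazard_sumS -[n.+2%:R]natr1 mulrDl mul1r lerD2r; apply: (le_trans IH).
      apply: ler_wpM2l; first exact: ler0n.
      exact: (good_path_hazard_incr alpha_gt0 beta_gt1).
    rewrite ler_pM2r; last exact: a0.
    rewrite -natrX ler_nat (leq_trans (leqnSn _))//.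
    by rewrite -{1}[n.+2]expn1 leq_exp2l.
  - exact: cvg_cst.
  - exact: increment_cvg.
rewrite (_ : (fun n => _) = (fun n => hazard_sum x n / hazard x n + 1)).
  have h := cvgD h0 (cvg_cst (1 : R)); rewrite add0r in h; exact: h.
apply/funext => n; rewrite hazard_sumS mulrDl divff// gt_eqF// hazard_fun_gt0.
by [].
Qed.

Section scaled_times.
(** Stands for either denominator in the limit law: the sum of the hazards or the exponential of the
    power of the mean. *)
Variable theta : nat -> (nat -> R) -> R.
Hypothesis theta_measurable : forall n, path_measurable (theta n).
Hypothesis theta_past : forall n, depends_on_past beta n (theta n).
Hypothesis theta_cvg :
  {ae P, forall w, theta n (path w) / hazard (path w) n @[n --> \oo] --> (1 : R)}.
Variable a : R.

(* T_(n+2) > a theta_n exactly when the gap after T_(n+1) exceeds [kappa n]. *)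
Let kappa n x : nat := Num.truncn (a * theta n x - (stime x n)%:R).
Let survival n x : R := (1 - (hazard x n)^-1) ^+ kappa n x.

Let kappa_measurable n : path_measurable (kappa n).
Proof.
move=> d' T' x mx; apply: measurable_truncn; apply: measurable_funB.
  by apply: measurable_funM => //; exact: theta_measurable.
exact: stimer_measurable.
Qed.

Let kappa_past n : depends_on_past beta n (kappa n).
Proof.
by move=> x x' vx xx'; rewrite /kappa (theta_past vx xx') (stime_past (leqnn n) vx xx').
Qed.

Let survival_measurable n : path_measurable (survival n).
Proof.
move=> d' T' x mx; apply: measurable_random_exp; last exact: kappa_measurable.
apply: measurable_funB => //; apply: measurable_inv_ge0; last exact: hazard_measurable.
by move=> w; rewrite ltW// hazard_fun_gt0.
Qed.

Let q01 n x : 0 <= 1 - (hazard x n)^-1 <= 1.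
Proof. by rewrite -weibull_cdf_hazard weibull_cdf_ge0/= ltW// weibull_cdf_lt1. Qed.

Let survival01 n x : 0 <= survival n x <= 1.
Proof.
have /andP[q0 q1] := q01 n x.
by rewrite exprn_ge0//= exprn_ile1.
Qed.

Let gap_le n x g : stime x n.+1 = (stime x n + g.+1)%N ->
  ((stime x n.+1)%:R <= a * theta n x) = (g < kappa n x)%N.
Proof. by move=> ->; rewrite truncn_gt_nat lerBrDl natrD. Qed.

Let early n x : R := ((stime x n.+1)%:R <= a * theta n x)%R%:R.
Let late n x : R := (a * theta n x < (stime x n.+1)%:R)%R%:R.

Let early_measurable n : path_measurable (early n).
Proof.
move=> d' T' x mx; apply: measurable_natr_bool; apply: measurable_fun_ler.
  exact: stimer_measurable.
by apply: measurable_funM => //; exact: theta_measurable.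
Qed.

Let late_measurable n : path_measurable (late n).
Proof.
move=> d' T' x mx; apply: measurable_natr_bool; apply: measurable_fun_ltr.
  by apply: measurable_funM => //; exact: theta_measurable.
exact: stimer_measurable.
Qed.

Let kappa_ltn_measurable n g : path_measurable (fun x => (g < kappa n x)%N%:R : R).
Proof.
move=> d' T' x mx; apply: measurable_natr_bool; apply: measurable_fun_ltn => //.
exact: kappa_measurable.
Qed.

Let kappa_gtn_measurable n g : path_measurable (fun x => (kappa n x < g)%N%:R : R).
Proof.
move=> d' T' x mx; apply: measurable_natr_bool; apply: measurable_fun_ltn => //.
exact: kappa_measurable.
Qed.

Let integral_early n :
  (\int[P]_w (early n (path w))%:E <= \int[P]_w (1 - survival n (path w))%:E)%E.
Proof.
have mh : path_measurable (fun x => 1 - survival n x).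
  by move=> d' T' x mx; apply: measurable_funB => //; exact: survival_measurable.
apply: (@integral_gap_le _ _ _ _ X alpha beta alpha_gt0 X_indep X_ge0 X_cdf n
  (fun g x => (g < kappa n x)%N%:R) (fun x => 1 - survival n x) (early n)) => //.
- by move=> g x x' vx xx'; rewrite (kappa_past vx xx').
- by move=> x; rewrite subr_ge0; case/andP: (survival01 n x).
- by move=> x g E; rewrite /early (gap_le E).
move=> x N; rewrite /survival; apply: le_trans (geometric_head_le (kappa n x) N (q01 n x)).
by rewrite opprB addrCA subrr addr0.
Qed.

Let integral_late n :
  (\int[P]_w (late n (path w))%:E <= \int[P]_w (survival n (path w))%:E)%E.
Proof.
apply: (@integral_gap_le _ _ _ _ X alpha beta alpha_gt0 X_indep X_ge0 X_cdf n
  (fun g x => (kappa n x < g.+1)%N%:R) (survival n) (late n)) => //.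
- by move=> g x x' vx xx'; rewrite (kappa_past vx xx').
- by move=> x; case/andP: (survival01 n x).
- by move=> x g E; rewrite /late ltNge (gap_le E) -leqNgt ltnS.
move=> x N; apply: le_trans (geometric_tail_le (kappa n x) N (q01 n x)).
by rewrite opprB addrCA subrr addr0.
Qed.

Let ae_survival_cvg : {ae P, forall w,
  survival n (path w) @[n --> \oo] --> expR (- Num.max a 0)}.
Proof.
apply: filterS3 good theta_cvg ae_stime_hazard_cvg0 => w gw ht hs; set x := path w.
have p0 n : 0 < (hazard x n)^-1 by rewrite invr_gt0 hazard_fun_gt0.
(* Selection times are at least 1, so the inverse hazard is at most the time-to-hazard ratio, which
   tends to 0. *)
have pcvg : (hazard x n)^-1 @[n --> \oo] --> (0 : R).
  apply: (@squeeze_cvgr _ _ _ _ (fun=> 0) (fun n => (stime x n)%:R / hazard x n)) => //.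
  - apply: nearW => n; rewrite (ltW (p0 n))/= ler_peMl ?(ltW (p0 n))//.
    by rewrite ler1n good_path_stime_ge1.
  - exact: cvg_cst.
apply: (@cvg_geometric_to_exp _ (fun n => (hazard x n)^-1) (kappa ^~ x)) => //.
  by move=> n; rewrite p0 invf_le1 ?hazard_ge1// hazard_fun_gt0.
apply: (@cvg_truncn_scaled _ (fun n => a * theta n x - (stime x n)%:R)) => //.
have h := cvgB (cvgM (cvg_cst a) ht) hs; rewrite mulr1 subr0 in h.
rewrite (_ : (fun n => _) = (fun n => a * (theta n x / hazard x n) -
   (stime x n)%:R / hazard x n)); first exact: h.
by apply/funext => n /=; rewrite mulrBl mulrA.
Qed.

Lemma stime_scaled_cvg :
  P [set w | (stime (path w) n.+1)%:R <= a * theta n (path w)] @[n --> \oo] -->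
    (1 - expR (- Num.max a 0))%:E.
Proof.
pose s n := (\int[P]_w (survival n (path w))%:E)%E.
have s0 x n : 0 <= survival n x by case/andP: (survival01 n x).
have s1 x n : survival n x <= 1 by case/andP: (survival01 n x).
have ms n : measurable_fun setT (fun w => (survival n (path w))%:E).
  by apply/measurable_EFinP; exact: survival_measurable.
have int_cst (c : R) : (\int[P]_w (cst c%:E w))%E = c%:E.
  by rewrite integral_cst// [X in (_ * X)%E]probability_setT mule1.
have scvg : s n @[n --> \oo] --> (expR (- Num.max a 0))%:E.
  have mc : measurable_fun setT (cst (expR (- Num.max a 0))%:E : T -> \bar R) by [].
  have cv : {ae P, forall w, setT w ->
      (survival n (path w))%:E @[n --> \oo] --> cst (expR (- Num.max a 0))%:E w}.
    apply: filterS ae_survival_cvg => w h _; apply: cvg_EFin => //.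
    exact: nearW.
  have ig : P.-integrable setT (cst 1%E : T -> \bar R).
    exact: finite_measure_integrable_cst.
  have dom : {ae P, forall w n, setT w -> (`|(survival n (path w))%:E| <= cst 1%E w)%E}.
    by apply: aeW => w n _; rewrite /= lee_fin ger0_norm.
  by have [_ _] := dominated_convergence measurableT ms mc cv ig dom; rewrite int_cst.
have sfin n : s n \is a fin_num.
  rewrite ge0_fin_numE; last by apply: integral_ge0 => w _; rewrite lee_fin.
  apply: (@le_lt_trans _ _ 1%E); last exact: ltry.
  rewrite -(int_cst 1); apply: ge0_le_integral => //.
  - by move=> w _; rewrite lee_fin.
  - by move=> w _; rewrite lee_fin.
pose E n := [set w | (stime (path w) n.+1)%:R <= a * theta n (path w)].
have mE n : measurable (E n).
  have mb : measurable_fun setT (fun w => (stime (path w) n.+1)%:R <= a * theta n (path w)).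
    apply: measurable_fun_ler; first exact: (@stimer_measurable _ beta n.+1).
    by apply: measurable_funM => //; exact: theta_measurable.
  have := mb measurableT [set true] I; rewrite setTI.
  by congr measurable; apply/seteqP; split => w /=.
(* The upper bounds for [E n] and for its complement add up to 1, so both are equalities. *)
have PE n : P (E n) = (1 - s n)%E.
  have earlyE : (\int[P]_w (early n (path w))%:E = P (E n))%E.
    rewrite -[in RHS](setIT (E n)) -integral_indic//; apply: eq_integral => w _.
    by rewrite indicE mem_setE.
  have lateE : (\int[P]_w (late n (path w))%:E = P (~` E n))%E.
    rewrite -[in RHS](setIT (~` E n)) -integral_indic//; last exact: measurableC.
    apply: eq_integral => w _.
    by rewrite indicE in_setC mem_setE /late ltNge.
  apply/eqP; rewrite eq_le; apply/andP; split.
    rewrite -earlyE; apply: (le_trans (integral_early n)).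
    under eq_integral do rewrite EFinB.
    rewrite integralB//; last 2 first.
    - exact: finite_measure_integrable_cst.
    - apply/integrableP; split => //; under eq_integral do rewrite gee0_abs ?lee_fin//.
      by rewrite ltey_eq [X in X || _](sfin n).
    by rewrite (int_cst 1).
  have := integral_late n; rewrite lateE probability_setC// -/(s n).
  rewrite -(fineK (sfin n)) -(fineK (fin_num_measure P _ (mE n))).
  by rewrite -!EFinB !lee_fin; lra.
rewrite (_ : (fun n => _) = (fun n => (1 - s n)%E)); last by apply/funext => n; exact: PE.
by rewrite EFinB; apply: cvgeB => //; exact: cvg_cst.
Qed.

End scaled_times.
End convergence_to_exponential.

(** The shift by two: stage k = n + 2 has time [stime] at n + 1 and is normalised by quantities of
    stage k - 1, which have index n. *)
Lemma cvg_in_distribution_scaled d (T : measurableType d) (R : realType)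
    (P : probability T R) (X : nat -> {RV P >-> R}) (alpha beta : R)
    (theta : nat -> (nat -> R) -> R) (Z : nat -> T -> R) :
  0 < alpha -> 1 < beta -> mutually_independent X ->
  (forall i, \forall w \ae P, 0 <= X i w) ->
  (forall i x, cdf (X i) x = (weibull_cdf alpha x)%:E) ->
  1 < alpha * (beta - 1) ->
  (forall n, path_measurable (theta n)) ->
  (forall n, depends_on_past beta n (theta n)) ->
  (forall n x, 0 < theta n x) ->
  {ae P, forall w, theta n (X ^~ w) / hazard alpha beta (X ^~ w) n @[n --> \oo] --> (1 : R)} ->
  (forall k, measurable_fun setT (Z k)) ->
  (forall n w, Z n.+2 w = (stime beta (X ^~ w) n.+1)%:R / theta n (X ^~ w)) ->
  cvg_in_distribution P Z (exponential_prob 1).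
Proof.
move=> alpha0 beta1 Xi X0 Xc g1 mt pt t0 tc mZ ZE; split => // a _.
rewrite exponential_cdf.
rewrite -(cvg_shiftS (fun n => P (Z n @^-1` `]-oo, a]))).
rewrite -(cvg_shiftS (fun n => P (Z n.+1 @^-1` `]-oo, a]))).
have h := stime_scaled_cvg (a := a) alpha0 beta1 Xi X0 Xc g1 mt pt tc.
rewrite (_ : (fun n => _) = (fun n =>
  P [set w | (stime beta (X ^~ w) n.+1)%:R <= a * theta n (X ^~ w)])); first exact: h.
apply/funext => n /=; congr (P _); apply/seteqP; split => w;
  by rewrite /preimage/= in_itv/= ZE ler_pdivrMr.
Qed.

Theorem theorem5p2 (d : measure_display) (T : measurableType d) (R : realType)
    (P : probability T R) (X : nat -> {RV P >-> R}) (alpha beta : R)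
    (alpha_gt0 : 0 < alpha) (beta_gt1 : 1 < beta)
    (X_indep : mutually_independent X)
    (X_ge0 : forall i, \forall w \ae P, 0 <= X i w)
    (X_cdf : forall i x, cdf (X i) x = (weibull_cdf alpha x)%:E) :
  let path (w : T) : nat -> R := fun i => X i w in
  let Tk k w : R := (selected_time beta (path w) k)%:R in
  let Tstar k w : R := normalized_time (weibull_cdf alpha) beta (path w) k in
  let Ybar k w : R := running_mean beta (path w) k in
  [/\ beta < 1 + (2 * alpha)^-1 ->
        cvg_almost_surely P Tstar 1,
      1 + (2 * alpha)^-1 <= beta < 1 + alpha^-1 ->
        cvg_in_probability P Tstar 1
    & 1 + alpha^-1 < beta ->
        cvg_in_distribution P Tstar (exponential_prob 1) /\
        cvg_in_distribution P
          (fun k w =>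
             Tk k w / expR (beta `^ alpha * (Ybar k.-1 w) `^ alpha))
          (exponential_prob 1)].
Proof.
move=> path Tk Tstar Ybar.
split=> [hb|/andP[_ hb]|hb].
- apply: (normalized_time_cvg_almost_surely alpha_gt0 beta_gt1 X_indep X_ge0 X_cdf).
  by rewrite -ltr_pdivlMl// ltrBlDl -invfM mulrC.
- apply: (normalized_time_cvg_in_probability alpha_gt0 beta_gt1 X_indep X_ge0 X_cdf).
  by rewrite -ltr_pdivlMl// mulr1 ltrBlDl.
have g1 : 1 < alpha * (beta - 1) by rewrite -ltr_pdivrMl// mulr1 ltrBrDl.
have good := ae_good_path alpha_gt0 X_indep X_ge0 X_cdf.
split.
  apply: (cvg_in_distribution_scaled (theta := fun n x => hazard_sum alpha beta x n.+1)
    alpha_gt0 beta_gt1 X_indep X_ge0 X_cdf g1).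
  - by move=> n; exact: hazard_sum_measurable.
  - by move=> n; exact: hazard_sum_past.
  - by move=> n x; exact: hazard_sum_gt0.
  - exact: (ae_hazard_sum_ratio_cvg1 alpha_gt0 beta_gt1 X_indep X_ge0 X_cdf g1).
  - by move=> k; exact: (@normalized_time_measurable _ alpha beta k).
  - by move=> n w; exact: normalized_time_stime.
have mean_measurable n : path_measurable (fun x => running_mean beta x n).
  move=> d' T' x mx; case: n => [|n].
    by under eq_fun do rewrite /running_mean invr0 mulr0; exact: measurable_cst.
  under eq_fun do rewrite running_mean_smean; exact: smean_measurable.
apply: (cvg_in_distribution_scaled
  (theta := fun n x => expR (beta `^ alpha * smean beta x n `^ alpha))
  alpha_gt0 beta_gt1 X_indep X_ge0 X_cdf g1).
- move=> n d' T' x mx; apply: (measurableT_comp (@measurable_expR R)).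
  apply: measurable_funM => //; apply: (measurableT_comp (measurable_powR _)).
  exact: smean_measurable.
- by move=> n x x' vx xx'; rewrite (smean_past (leqnn n) vx xx').
- by move=> n x; exact: expR_gt0.
- apply: filterS good => w gw.
  (* On a good path the mean is positive, so the power splits and this [theta] equals the hazard. *)
  rewrite (_ : (fun n => _) = (fun=> 1)); first exact: cvg_cst.
  apply/funext => n; rewrite (good_path_hazard alpha beta_gt1)//.
  rewrite -powRM ?divff ?gt_eqF ?expR_gt0 ?ltW//; last exact: good_path_smean_gt0.
  exact: lt_trans beta_gt1.
- move=> k; apply: measurable_funM.
    exact: (@stimer_measurable R beta k.-1).
  apply: measurable_inv_ge0; first by move=> w; exact: expR_ge0.
  apply: (measurableT_comp (@measurable_expR R)).
  apply: measurable_funM => //; apply: (measurableT_comp (measurable_powR _)).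
  exact: (@mean_measurable k.-1).
- by move=> n w; rewrite /Ybar running_mean_smean.
Qed.
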